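(* Let $\Gamma$ be any tree of height $N\le\infty$, let $\{X(\sigma):\sigma\ne\rho\}$ be i.i.d. real random variables, and let $B\subseteq\mathbf{R}^N$ be any target set. For finite integers $k\le j\le N$ and real numbers $x_1,\ldots,x_k$ define $$p_j(x_1,\ldots,x_k)=\mathbf{P}\big((X_{k+1},\ldots,X_j)\in\pi_j(B)/x_1\cdots x_k\big),$$ the measure of the cross section at $x_1,\ldots,x_k$ of the projection of $B$ onto the first $j$ coordinates, where $X_1,X_2,\ldots$ are i.i.d. with the common distribution of the $X(\sigma)$. Suppose that for every $k$ and every fixed $x_1,\ldots,x_{k-1}$, the matrix $M$ whose $(y,j)$-entry is $p_j(x_1,\ldots,x_{k-1},y)$ is totally positive of order two, i.e. $M_{xi}M_{yj}\ge M_{yi}M_{xj}$ whenever $k\le i<j$ and $x<y$. Let $\mathcal{S}(B)=\{y\in\mathbf{R}^N:y_i\le b_i\text{ for all finite } i\le N\}$ with $b_i$ chosen so that $\prod_{i=1}^n\mathbf{P}(X(\sigma)\le b_i)=p(B;n)$ for all finite $n\le N$. Then $$\mathbf{P}(B;\rho\leftrightarrow\partial\Gamma)\le\mathbf{P}(\mathcal{S}(B);\rho\leftrightarrow\partial\Gamma).$$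
   Context: Trees here are locally finite rooted trees with root $\rho$, of height $N\le\infty$: if $N=\infty$ the tree is infinite without leaves; if $N<\infty$ all maximal paths from the root have length $N$. $|\sigma|$ is the distance from $\rho$ to $\sigma$, $\Gamma_n=\{\sigma:|\sigma|=n\}$. Maximal paths from the root are called rays; $\partial\Gamma$ is the set of rays. Target percolation: given i.i.d. real $\{X(\sigma):\sigma\ne\rho\}$ and a closed set $B\subseteq\mathbf{R}^N$ (the target set), let $W$ be the set of vertices consisting of $\rho$ and all $\sigma\in\Gamma_k$, $1\le k\le N$ finite, such that $(X(\tau_1),\ldots,X(\tau_k))\in\pi_kB$, where $\rho,\tau_1,\ldots,\tau_k=\sigma$ is the path from $\rho$ to $\sigma$ and $\pi_k$ is projection to the first $k$ coordinates. $\{\rho\leftrightarrow\sigma\}$ is the event that $W$ contains the path from $\rho$ to $\sigma$, and $\{\rho\leftrightarrow\partial\Gamma\}$ the event that $W$ contains a ray. $\mathbf{P}(B;\cdot)$ indicates the target set used, and $p(B;n)=\mathbf{P}(B;\rho\leftrightarrow\sigma)$ for $|\sigma|=n$. For $A\subseteq\mathbf{R}^j$, $A/x_1\cdots x_k=\{(y_{k+1},\ldots,y_j):(x_1,\ldots,x_k,y_{k+1},\ldots,y_j)\in A\}$; when $j=k$, $p_k(x_1,\ldots,x_k)$ is $1$ if $(x_1,\ldots,x_k)\in\pi_k(B)$ and $0$ otherwise. *)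

(* Defs.v *)
(* MathComp-Analysis, over an arbitrary R : realType. *)
From HB Require Import structures.
From mathcomp Require Import all_boot all_order all_algebra.
From mathcomp Require Import finmap.
From mathcomp Require Import all_classical all_reals all_analysis.
Set Implicit Arguments.
Unset Strict Implicit.
Unset Printing Implicit Defensive.
Import Order.TTheory GRing.Theory Num.Theory.
Import numFieldNormedType.Exports.
Local Open Scope classical_set_scope.
Local Open Scope ring_scope.

(* N : option nat is an element of {0, 1, 2, ...} \cup {oo}; None is oo. *)
Definition le_height (k : nat) (N : option nat) : bool :=
  if N is Some n then (k <= n)%N else true.

(* A rooted tree given by its parent map.  Every vertex is brought to rho, a
   fixed point of [parent], by iterating [parent]; this excludes cycles and
   makes the graph connected.  The children of s are the t <> rho with
   parent t = s. *)
Record tree := Tree {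
  vertex :> choiceType;
  rho : vertex;
  parent : vertex -> vertex;
  parent_root : parent rho = rho;
  reach_root : forall s, exists n, iter n parent s == rho;
  locally_finite : forall s, finite_set [set t | parent t = s]
}.
Arguments rho {t}.
Arguments parent {t}.

Section Tree.
Variable G : tree.
Implicit Types (s t : G) (Q : set G).

(* |s|, the distance from the root *)
Definition depth s : nat := ex_minn (reach_root s).

(* Paths starting at the root, as sets of vertices: closed under [parent], with
   at most one vertex at each level. *)
Definition root_path Q :=
  [/\ Q rho, (forall s, Q s -> Q (parent s)) &
      (forall s t, Q s -> Q t -> depth s = depth t -> s = t)].

Definition ray Q :=
  root_path Q /\ (forall Q', root_path Q' -> Q `<=` Q' -> Q' `<=` Q).

Definition path_length Q (n : nat) :=
  (exists2 s, Q s & depth s = n) /\ (forall s, Q s -> (depth s <= n)%N).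

(* A tree without leaves contains infinite paths, so it is infinite. *)
Definition has_height (N : option nat) :=
  match N with
  | Some n => forall Q, ray Q -> path_length Q n
  | None => forall s, exists2 t, t <> rho & parent t = s
  end.

Definition path_to s : set G := [set iter i parent s | i in [set: nat]].

(* tau_1, ..., tau_k, where rho, tau_1, ..., tau_k = s is the path to s *)
Definition path_seq s : seq G :=
  [seq iter (depth s - i) parent s | i <- iota 1 (depth s)].

End Tree.

(* R^N with the product topology.  The paper's i-th coordinate (i >= 1) is
   the coordinate of index i - 1 here. *)
Definition coord_index (N : option nat) := {i : nat | le_height i.+1 N}.
Definition Rpow (R : realType) (N : option nat) := {ptws coord_index N -> R}.

Section TargetPercolation.
Variables (R : realType) (N : option nat).
Implicit Types (B : set (Rpow R N)) (x : seq R).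

(* The default value 0 is never used when i < N. *)
Definition coord (y : Rpow R N) (i : nat) : R :=
  if insub i is Some j then y j else 0.

(* pi_k B for k <= N; points of R^k are lists of length k. *)
Definition proj_target (k : nat) B : set (seq R) :=
  [set mkseq (coord y) k | y in B].

(* A / x_1 ... x_k *)
Definition cross_section (A : set (seq R)) x : set (seq R) :=
  [set z | A (x ++ z)].

(* { y : y_i <= b_i for all finite i <= N }.  The b_i are extended reals: if
   p(B; 1) = 1 and the X(s) are unbounded above, then b_1 has to be +oo. *)
Definition corner (b : nat -> \bar R) : set (Rpow R N) :=
  [set y | forall i : coord_index N, ((y i)%:E <= b (val i))%E].

(* When N = oo, pi_k B is the projection of a closed subset of R^oo: it is
   analytic, but need not be Borel, and the events below then belong only to
   the completion of P.  Hence probabilities are taken in the completion of P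
   (the outer measure of P restricted to Caratheodory measurable sets), which
   agrees with P on measurable sets. *)
Definition prob d (T : measurableType d) (P : probability T R) (A : set T) :
    \bar R :=
  @completed_measure_extension d T R P A.

(* The (X i), i in D, are i.i.d. with law mu. *)
Definition iid (I : choiceType) (D : set I) d (T : measurableType d)
    (P : probability T R) (X : I -> {RV P >-> R}) (mu : probability R R) :=
  (forall i, D i -> forall A : set R, measurable A ->
     distribution P (X i) A = mu A) /\
  (forall J : {fset I}, [set` J] `<=` D ->
     forall A : I -> set R, (forall i, measurable (A i)) ->
     P (\bigcap_(i in [set` J]) (X i @^-1` A i)) =
     (\prod_(i <- J) P (X i @^-1` A i))%E).

Section Percolation.
Variables (G : tree) (d : measure_display) (T : measurableType d).
Variables (P : probability T R) (X : G -> {RV P >-> R}).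

(* The random set W; X rho is never used. *)
Definition open_vertices B (w : T) : set G :=
  [set s | s = rho \/
     proj_target (depth s) B [seq X t w | t <- path_seq s]].

Definition root_to B (s : G) : set T :=
  [set w | path_to s `<=` open_vertices B w].

Definition root_to_boundary B : set T :=
  [set w | exists2 Q, ray Q & Q `<=` open_vertices B w].

End Percolation.

(* p_j(x_1, ..., x_k) with k = size x <= j; Y i is the paper's X_{i+1}.  For
   j = k it is the indicator of pi_k B at x. *)
Definition section_prob d (T : measurableType d) (P : probability T R)
    (Y : nat -> {RV P >-> R}) B (j : nat) x : \bar R :=
  prob P [set w | cross_section (proj_target j B) x
                    [seq Y i w | i <- iota (size x) (j - size x)]].

End TargetPercolation.
Arguments corner {R} N b.

(* Total positivity of order two for a matrix with real row index and column
   index in D. *)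
Definition tp2 (R : realType) (D : set nat) (M : R -> nat -> \bar R) :=
  forall (x y : R) (i j : nat), D i -> D j -> (i < j)%N -> x < y ->
    (M y i * M x j <= M x i * M y j)%E.

(* Main.v *)
Require Import Defs.
From HB Require Import structures.
From mathcomp Require Import all_boot all_order all_algebra.
From mathcomp Require Import finmap.
From mathcomp Require Import all_classical all_reals all_analysis.
From mathcomp Require Import measurable_realfun.
From mathcomp Require Import ring lra zify.
Import Order.TTheory GRing.Theory Num.Theory.
Import numFieldNormedType.Exports.
Local Open Scope classical_set_scope.
Local Open Scope ring_scope.
Set Implicit Arguments.
Unset Strict Implicit.
Unset Printing Implicit Defensive.

(* For a vertex v at level k let F_v(p_k, ..., p_n) be p_k times the
   probability that independent percolation below v, retaining an edge from
   level j to level j + 1 with probability p_(j+1) / p_j, reaches level n.  If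
   the vectors p(y) are ordered by monotone ratios, then
   \int F_v(p(y)) dmu(y) <= F_v(\int p(y) dmu(y)): by induction on the tree, the
   survival probabilities F_t(p(y)) / p_k(y) of the children t are monotone in
   y, so Chebyshev's association inequality applies to the product of the
   failure probabilities.  Total positivity says exactly that the vectors
   p_j(x_1, ..., x_(k-1), y) are so ordered, and conditioning on the values at
   the children shows by induction that, given x_1, ..., x_k on the path to v,
   the target percolation below v reaches level n with probability at most
   F_v(p_k(x), ..., p_n(x)).  At the root, F is the probability that the
   percolation with target S(B) reaches level n.

   The projections of B are only analytic, so B is replaced by its intersection
   with compact boxes, where all events are measurable; Choquet's capacity
   argument shows that no outer probability is lost. *)

(** * Survival of independent percolation *)

(** Conditional probabilities may vanish, so the retention ratios are never formed: F_v is
    homogeneous of degree one in p, and comparisons of ratios are cross-multiplied. Boxing B may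
    destroy total positivity, which is assumed for B alone. Hence only the percolation event is
    boxed, while the vectors p stay outer probabilities of sections of B. Two facts reconcile the
    two sides. The entries of p(y) are measurable in y because total positivity makes them monotone
    wherever the leading entry is 1. And \int p(y) dmu(y) <= p holds entrywise for outer
    probabilities; this inequality suffices because F_v increases with p. The comparison is made at
    each finite level n. For B, the boundary event lies in every level-n event; for S(B), Koenig's
    lemma turns survival to all levels into a ray. *)

Section Survival.
Variables (R : realFieldType) (V : Type) (kids : V -> seq V).
Implicit Types (p q : nat -> R) (x y u a : R).

(* x times the probability of the union of independent events of probabilities
   u / x and a / x; only used with 0 <= u, a <= x, so it is 0 when x = 0. *)
Definition por (x u a : R) := u + a - u * a / x.

Fixpoint surv m k v p : R :=
  if m is m'.+1 then
    foldr (fun t a => por (p k) (surv m' k.+1 t p) a) 0 (kids v)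
  else p k.

Definition dominated (k : nat) p :=
  forall j, (k <= j)%N -> 0 <= p j.+1 /\ p j.+1 <= p j.

Lemma dominated_ge0 k p : dominated k p -> 0 <= p k.
Proof. by move=> /(_ k (leqnn _)) [h1 h2]; apply: le_trans h2. Qed.

Lemma dominatedS k p : dominated k p -> dominated k.+1 p.
Proof. by move=> h j kj; apply: h; apply: ltnW. Qed.

Lemma por_bounds x u a : 0 <= u <= x -> 0 <= a <= x -> 0 <= por x u a <= x.
Proof.
rewrite /por => /andP[u0 ux] /andP[a0 ax].
have [x0|x0] := eqVneq x 0.
  by rewrite x0 in ux ax *; rewrite invr0 mulr0 subr0; lra.
have xp : 0 < x by rewrite lt_def x0; exact: le_trans ux.
have e : u * a / x = u * (a / x) by rewrite mulrA.
have r0 : 0 <= a / x by rewrite divr_ge0 // ltW.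
have r1 : a / x <= 1 by rewrite ler_pdivrMr // mul1r.
have ea : a = x * (a / x) by rewrite mulrCA divff // mulr1.
rewrite e; move: r0 r1 ea; move: (a / x) => r r0 r1 ->; nra.
Qed.

(** A larger scale lowers the overlap term [u * a / x]; at the common scale [y] what remains is
    monotonicity of r + s - r s on the unit square. *)
Lemma por_le x y u u' a a' : 0 <= u <= x -> 0 <= a <= x ->
  u <= u' -> u' <= y -> a <= a' -> a' <= y -> x <= y -> por x u a <= por y u' a'.
Proof.
move=> /andP[u0 ux] /andP[a0 ax] uu' u'y aa' a'y xy; rewrite /por.
have [x0|x0] := eqVneq x 0.
  have u00 : u = 0 by lra.
  have a00 : a = 0 by lra.
  have := @por_bounds y u' a'; rewrite /por u00 a00 mul0r mul0r; lra.
have xp : 0 < x by rewrite lt_def x0; exact: le_trans ux.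
have yp : 0 < y by lra.
apply: (@le_trans _ _ (u + a - u * a / y)).
  rewrite lerD2l lerN2 ler_pdivrMr // mulrAC ler_pdivlMr //.
  by rewrite ler_wpM2l // mulr_ge0.
have h w z : w * z / y = y * ((w / y) * (z / y)) by field; lra.
rewrite !h.
have dv w w' : w <= w' -> w / y <= w' / y by move=> ?; rewrite ler_pM2r // invr_gt0.
have d0 w : 0 <= w -> 0 <= w / y by move=> ?; rewrite divr_ge0 // ltW.
have d1 w : w <= y -> w / y <= 1 by move=> ?; rewrite ler_pdivrMr // mul1r.
have dm w : w = y * (w / y) by rewrite mulrCA divff ?mulr1 // gt_eqF.
rewrite {1}(dm u) {1}(dm a) {1}(dm u') {1}(dm a') -!mulrDr -!mulrBr ler_pM2l //.
have := dv _ _ uu'; have := dv _ _ aa'; have := d0 _ u0; have := d0 _ a0.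
have := d1 _ u'y; have := d1 _ a'y.
move: (u / y) (a / y) (u' / y) (a' / y) => r s r' s' *; nra.
Qed.

Lemma surv_bounds m k v p : dominated k p -> 0 <= surv m k v p <= p k.
Proof.
elim: m k v => [|m IH] k v hp /=; first by rewrite dominated_ge0 //=.
have hk := dominated_ge0 hp.
elim: (kids v) => [|t ts IHt] /=; first by rewrite lexx.
apply: por_bounds => //; have /andP[-> h] /= := IH k.+1 t (dominatedS hp).
by apply: le_trans h _; case: (hp k).
Qed.

Lemma surv_fold_bounds m k ts p : dominated k p ->
  0 <= foldr (fun t a => por (p k) (surv m k.+1 t p) a) 0 ts <= p k.
Proof.
move=> hp; have hk := dominated_ge0 hp.
elim: ts => [|t ts IHt] /=; first by rewrite lexx.
apply: por_bounds => //; have /andP[-> h] /= := surv_bounds m t (dominatedS hp).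
by apply: le_trans h _; case: (hp k).
Qed.

Lemma surv_child_bounds m k t p : dominated k p ->
  0 <= surv m k.+1 t p <= p k.
Proof.
move=> hp; have /andP[-> h] /= := surv_bounds m t (dominatedS hp).
by apply: le_trans h _; case: (hp k).
Qed.

(** Raising [p] may lower a retention ratio [p j.+1 / p j]; monotonicity survives because [por]
    increases in its scale as well as in both arguments. *)
Lemma surv_le m k v p q : dominated k p -> dominated k q ->
  (forall j, (k <= j)%N -> p j <= q j) -> surv m k v p <= surv m k v q.
Proof.
elim: m k v => [|m IH] k v hp hq pq /=; first exact: pq.
elim: (kids v) => [|t ts IHt] //=.
have /andP[? ?] := surv_child_bounds m t hq.
have /andP[? ?] := surv_fold_bounds m ts hq.
apply: por_le => //; [exact: surv_child_bounds|exact: surv_fold_bounds| |exact: pq].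
by apply: IH; [exact: dominatedS|exact: dominatedS|move=> j kj; apply/pq/ltnW].
Qed.

(** Divided by its scale, [por x u a] is r + s - r s with r = u / x and s = a / x, which increases
    in both on the unit square. *)
Lemma por_ratio x y u u' a a' : 0 <= u <= x -> 0 <= a <= x ->
  0 <= u' <= y -> 0 <= a' <= y -> u * y <= u' * x -> a * y <= a' * x ->
  por x u a * y <= por y u' a' * x.
Proof.
move=> hu ha hu' ha' ruu raa.
have [x0|x0] := eqVneq x 0.
  by have := por_bounds hu ha; rewrite {1 3}x0; rewrite x0 mulr0; nra.
have [y0|y0] := eqVneq y 0.
  have := por_bounds hu' ha'; have := por_bounds hu ha; rewrite y0 mulr0; nra.
move: hu ha hu' ha' => /andP[u0 ux] /andP[a0 ax] /andP[u'0 u'y] /andP[a'0 a'y].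
have xp : 0 < x by rewrite lt_def x0; exact: le_trans ux.
have yp : 0 < y by rewrite lt_def y0; exact: le_trans u'y.
have h z w b : z != 0 -> por z w b = z * (w / z + b / z - (w / z) * (b / z)).
  by move=> z0; rewrite /por; field.
rewrite !h // mulrAC -[leRHS]mulrAC (mulrC y x) ler_pM2l ?mulr_gt0 //.
have dv w w' : w * y <= w' * x -> w / x <= w' / y.
  by move=> ?; rewrite ler_pdivrMr // mulrAC ler_pdivlMr.
have := dv _ _ ruu; have := dv _ _ raa.
have d0 w : 0 <= w -> 0 <= w / x by move=> ?; rewrite divr_ge0 // ltW.
have d1 w : w <= y -> w / y <= 1 by move=> ?; rewrite ler_pdivrMr // mul1r.
have := d0 _ u0; have := d0 _ a0; have := d1 _ u'y; have := d1 _ a'y.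
move: (u / x) (a / x) (u' / y) (a' / y) => r s r' s' *; nra.
Qed.

Definition ratio_le (k : nat) p q :=
  forall i j, (k <= i)%N -> (i < j)%N -> q i * p j <= p i * q j.

(** The free index [i] serves the induction: children live at level [k.+1] but are compared relative
    to entry [k] of their parent. The case [i = k] comes from [por_ratio]; a smaller [i] multiplies
    this by the ratio order between entries [i] and [k]. *)
Lemma surv_ratio m k v p q i : (i <= k)%N -> dominated i p -> dominated i q ->
  ratio_le i p q -> surv m k v p * q i <= surv m k v q * p i.
Proof.
elim: m k v i => [|m IH] k v i ik hp hq pq /=.
  move: ik; rewrite leq_eqVlt => /predU1P[->|ik]; first by rewrite mulrC.
  by rewrite mulrC [leRHS]mulrC; exact: pq.
have hpk : dominated k p by move=> j kj; apply: hp; apply: leq_trans kj.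
have hqk : dominated k q by move=> j kj; apply: hq; apply: leq_trans kj.
have pqk : ratio_le k p q by move=> ? ? kj; apply: pq; apply: leq_trans kj.
set A := foldr _ _ _; set B := foldr _ _ _.
have AB : A * q k <= B * p k.
  rewrite /A /B; elim: (kids v) => [|t ts IHt] /=; first by rewrite !mul0r.
  apply: por_ratio => //; try exact: surv_child_bounds; try exact: surv_fold_bounds.
  exact: IH.
have /andP[A0 Ap] : 0 <= A <= p k := surv_fold_bounds m (kids v) hpk.
have /andP[B0 Bq] : 0 <= B <= q k := surv_fold_bounds m (kids v) hqk.
move: ik; rewrite leq_eqVlt => /predU1P[->//|ik].
have hik := pq i k (leqnn _) ik.
have [pk0|pk0] := eqVneq (p k) 0.
  have -> : A = 0 by lra.
  by rewrite mul0r mulr_ge0 // dominated_ge0.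
have pkp : 0 < p k by rewrite lt_def pk0 dominated_ge0.
have pi0 := dominated_ge0 hp; have qi0 := dominated_ge0 hq.
have [qk0|qk0] := eqVneq (q k) 0.
  (* With [p k > 0] and [q k = 0], the ratio order between [i] and [k] forces [q i = 0]. *)
  have : q i * p k <= 0 by rewrite qk0 mulr0 in hik.
  rewrite pmulr_lle0 // => qi; have -> : q i = 0 by lra.
  by rewrite mulr0 mulr_ge0.
have qkp : 0 < q k by rewrite lt_def qk0 dominated_ge0.
rewrite -(ler_pM2r (mulr_gt0 pkp qkp)).
have -> : A * q i * (p k * q k) = (A * q k) * (q i * p k) by ring.
have -> : B * p i * (p k * q k) = (B * p k) * (p i * q k) by ring.
by apply: ler_pM => //; rewrite mulr_ge0 // ltW.
Qed.

End Survival.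

(** * Chebyshev's inequality and Jensen's inequality for survival *)

Section Jensen.
Variables (R : realType) (mu : probability R R).
Implicit Types f g u a p : R -> R.

Lemma measurable_inv : measurable_fun [set: R] (@GRing.inv R).
Proof.
rewrite -(setvU [set 0 : R]); apply/measurable_funU => //.
  by apply: measurableC.
split; last first.
  move=> _ B mB.
  have [B0|B0] := pselect (B 0).
    by rewrite (_ : _ `&` _ = [set 0]) //; apply/seteqP; split=> [x []|x ->] //=;
      rewrite invr0.
  by rewrite (_ : _ `&` _ = set0) //; apply/seteqP; split=> [x [->]|x] //=;
    rewrite invr0.
apply: open_continuous_measurable_fun.
  by apply: closed_openC; exact: closed_eq.
by move=> x; rewrite inE /= => /eqP x0; apply: inv_continuous.
Qed.

Lemma measurable_unit_integrable f : measurable_fun setT f ->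
  (forall x, 0 <= f x <= 1) -> mu.-integrable setT (EFin \o f).
Proof.
move=> mf f01; apply: measurable_bounded_integrable => //.
  by rewrite (le_lt_trans (probability_le1 _ _)) // ltry.
exists 1; split => // M M1 x _ /=.
by case/andP: (f01 x) => f0 f1; rewrite ger0_norm //; apply: le_trans (ltW M1).
Qed.

Lemma measurable_por p u a : measurable_fun setT p -> measurable_fun setT u ->
  measurable_fun setT a -> measurable_fun setT (fun x => por (p x) (u x) (a x)).
Proof.
move=> mp mu' ma; apply: measurable_funB; first exact: measurable_funD.
apply: measurable_funM; first exact: measurable_funM.
by apply: measurableT_comp => //; exact: measurable_inv.
Qed.

Definition comonotone p u := forall x y, x < y -> u x * p y <= u y * p x.

(* Integrate the inequality [(u - c p) (a / p - g) >= 0], where [g] is the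
   mean of [a / p] for the measure [p dmu] and [c] the supremum of [u / p] over
   [a / p < g]. *)
Lemma chebyshev p u a :
  measurable_fun setT p -> measurable_fun setT u -> measurable_fun setT a ->
  (forall x, 0 <= u x <= p x) -> (forall x, 0 <= a x <= p x) ->
  (forall x, p x <= 1) -> comonotone p u -> comonotone p a ->
  (\int[mu]_x u x) * (\int[mu]_x a x) / (\int[mu]_x p x)
    <= \int[mu]_x (u x * a x / p x).
Proof.
move=> mp mu' ma up ap p1 cu ca.
have p0 x : 0 <= p x by case/andP: (up x); exact: le_trans.
have div1 x : 0 <= u x * a x / p x <= 1.
  have /andP[u0 u1] := up x; have /andP[a0 a1] := ap x.
  rewrite divr_ge0 ?mulr_ge0 //=.
  have [->|px] := eqVneq (p x) 0; first by rewrite invr0 mulr0.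
  have pp : 0 < p x by rewrite lt_def px p0.
  rewrite ler_pdivrMr // mul1r; apply: le_trans u1.
  by rewrite ler_piMr // (le_trans a1).
have mdiv : measurable_fun setT (fun x => u x * a x / p x).
  apply: measurable_funM; first exact: measurable_funM.
  by apply: measurableT_comp => //; exact: measurable_inv.
have ip : mu.-integrable setT (EFin \o p).
  by apply: measurable_unit_integrable => // x; rewrite p0 p1.
have iu : mu.-integrable setT (EFin \o u).
  apply: measurable_unit_integrable => // x; case/andP: (up x) => -> h.
  exact: le_trans h _.
have ia : mu.-integrable setT (EFin \o a).
  apply: measurable_unit_integrable => // x; case/andP: (ap x) => -> h.
  exact: le_trans h _.
have idiv : mu.-integrable setT (EFin \o (fun x => u x * a x / p x)).
  exact: measurable_unit_integrable.
have Ip0 : 0 <= \int[mu]_x p x by apply: Rintegral_ge0.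
have [->|Ip] := eqVneq (\int[mu]_x p x) 0.
  by rewrite invr0 mulr0; apply: Rintegral_ge0 => x _; case/andP: (div1 x).
have Ipp : 0 < \int[mu]_x p x by rewrite lt_def Ip.
set g := (\int[mu]_x a x) / (\int[mu]_x p x).
have Ia : \int[mu]_x a x = g * \int[mu]_x p x by rewrite /g divfK.
(* Including 0 keeps the supremum defined when no [x] has [a x / p x < g], and 0 lies below every
   ratio [u x / p x]. *)
pose S : set R := [set r | r = 0 \/ exists x, [/\ 0 < p x, a x < g * p x & r = u x / p x]].
have S1 r : S r -> r <= 1.
  move=> [->//|[x [px _ ->]]]; rewrite ler_pdivrMr // mul1r.
  by case/andP: (up x).
have hS : has_sup S by split; [exists 0; left|exists 1 => r /S1].
set c := sup S.
have cS r : S r -> r <= c by move=> Sr; apply: ub_le_sup => //; case: hS.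
have key x : g * u x + c * a x - c * g * p x <= u x * a x / p x.
  have [px0|px0] := eqVneq (p x) 0.
    have /andP[u0 u1] := up x; have /andP[a0 a1] := ap x.
    have -> : u x = 0 by lra.
    have -> : a x = 0 by lra.
    by rewrite px0 !mulr0 !mul0r; lra.
  have px : 0 < p x by rewrite lt_def px0 p0.
  have -> : u x * a x / p x = p x * ((u x / p x) * (a x / p x)) by field.
  have eu : u x = p x * (u x / p x) by field.
  have ea : a x = p x * (a x / p x) by field.
  rewrite {1}eu {1}ea.
  have -> : g * (p x * (u x / p x)) + c * (p x * (a x / p x)) - c * g * p x =
    p x * (g * (u x / p x) + c * (a x / p x) - c * g) by ring.
  rewrite ler_pM2l //.
  suff : 0 <= (u x / p x - c) * (a x / p x - g) by lra.
  have [ag|ag] := ltP (a x) (g * p x).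
    have h1 : u x / p x <= c by apply: cS; right; exists x.
    have h2 : a x / p x <= g by rewrite ler_pdivrMr // ltW.
    by rewrite mulr_le0 // subr_le0.
  rewrite mulr_ge0 // subr_ge0; last by rewrite ler_pdivlMr.
  apply: ge_sup; first by case: hS.
  move=> r [->|[y [py ay ->]]]; first by rewrite divr_ge0 //; case/andP: (up x).
  rewrite ler_pdivrMr // mulrAC ler_pdivlMr //.
  (* Here [y] cannot exceed [x]: [a / p] is nondecreasing, yet [a y / p y < g <= a x / p x]. *)
  case: (ltgtP x y) => [xy|yx|<-].
  - have : a x / p x <= a y / p y.
      by rewrite ler_pdivrMr // mulrAC ler_pdivlMr //; exact: ca.
    have : g <= a x / p x by rewrite ler_pdivlMr.
    have : a y / p y < g by rewrite ltr_pdivrMr.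
    lra.
  - exact: cu.
  - by [].
have iZ r f : mu.-integrable setT (EFin \o f) ->
    mu.-integrable setT (EFin \o (fun x => r * f x)).
  by move=> h; apply: (eq_integrable measurableT _ _ _ (integrableZl measurableT r h)).
have iD f f' : mu.-integrable setT (EFin \o f) -> mu.-integrable setT (EFin \o f') ->
    mu.-integrable setT (EFin \o (fun x => f x + f' x)).
  by move=> h h'; apply: (eq_integrable measurableT _ _ _ (integrableD measurableT h h')).
have iB f f' : mu.-integrable setT (EFin \o f) -> mu.-integrable setT (EFin \o f') ->
    mu.-integrable setT (EFin \o (fun x => f x - f' x)).
  by move=> h h'; apply: (eq_integrable measurableT _ _ _ (integrableB measurableT h h')).
have : \int[mu]_x (g * u x + c * a x - c * g * p x) <= \int[mu]_x (u x * a x / p x).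
  apply: le_Rintegral => //.
  by apply: iB; [apply: iD; exact: iZ|exact: iZ].
rewrite RintegralB //; [|by apply: iD; exact: iZ|exact: iZ].
rewrite RintegralD //; try exact: iZ.
(* By the choice of [g], the two terms containing [c] cancel. *)
rewrite !RintegralZl // Ia.
have -> : (\int[mu]_x u x) * (g * \int[mu]_x p x) / (\int[mu]_x p x) =
  g * \int[mu]_x u x by field.
lra.
Qed.

Section Tree.
Variables (V : Type) (kids : V -> seq V) (p : R -> nat -> R).
Hypothesis mp : forall j, measurable_fun setT (p^~ j).
Hypothesis p1 : forall x j, p x j <= 1.

Lemma measurable_surv m k v : measurable_fun setT (fun x => surv kids m k v (p x)).
Proof.
elim: m k v => [|m IH] k v //=.
elim: (kids v) => [|t ts IHt] //=.
exact: measurable_por.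
Qed.

Let mean j := \int[mu]_x p x j.

Lemma dominated_mean k : (forall x, dominated k (p x)) -> dominated k mean.
Proof.
move=> hp j kj.
have i j' : (k <= j')%N -> mu.-integrable setT (EFin \o p^~ j').
  move=> kj'; apply: measurable_unit_integrable => // x; rewrite p1 andbT.
  by case: (hp x j' kj'); exact: le_trans.
split; first by apply: Rintegral_ge0 => x _; case: (hp x j kj).
apply: le_Rintegral => //; first by apply: i; exact: leqW.
  exact: i.
by move=> x _; case: (hp x j kj).
Qed.

Lemma surv_jensen m k v : (forall x, dominated k (p x)) ->
  (forall x y, x < y -> ratio_le k (p x) (p y)) ->
  \int[mu]_x surv kids m k v (p x) <= surv kids m k v mean.
Proof.
elim: m k v => [|m IH] k v hp hr //=.
have hp' x : dominated k.+1 (p x) by apply: dominatedS; apply: hp.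
have hr' x y : x < y -> ratio_le k.+1 (p x) (p y).
  by move=> xy i j ki; apply: hr => //; exact: ltnW.
have cu t : comonotone (p^~ k) (fun x => surv kids m k.+1 t (p x)).
  by move=> x y xy; apply: surv_ratio => //; exact: hr.
have hm := dominated_mean hp; have hm' := dominatedS hm.
set w := fun x => foldr _ _ _.
(* Chebyshev is applied once per child, to its survival [u] and the union [w] over the remaining
   children; so measurability, bounds and comonotonicity of [w] travel through the induction along
   with the inequality. *)
suff : [/\ measurable_fun setT w, forall x, 0 <= w x <= p x k, comonotone (p^~ k) w
   & \int[mu]_x w x <= foldr (fun t => por (mean k) (surv kids m k.+1 t mean)) 0 (kids v)].
  by case.
rewrite {}/w; elim: (kids v) => [|t ts [mw w0 cw Iw]] /=.
  split=> //; first by move=> x; rewrite lexx dominated_ge0.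
    by move=> x y xy; rewrite !mul0r.
  by rewrite Rintegral_cst // mul0r.
set w := fun x => foldr _ _ _ in mw w0 cw Iw.
set u := fun x => surv kids m k.+1 t (p x).
have mu' : measurable_fun setT u by exact: measurable_surv.
have u0 x : 0 <= u x <= p x k by exact: surv_child_bounds.
split.
- exact: measurable_por.
- by move=> x; exact: por_bounds (u0 x) (w0 x).
- by move=> x y xy; exact: por_ratio (u0 x) (w0 x) (u0 y) (w0 y) (cu t _ _ xy) (cw _ _ xy).
have unit f : measurable_fun setT f -> (forall x, 0 <= f x <= p x k) ->
    mu.-integrable setT (EFin \o f).
  move=> mf h; apply: measurable_unit_integrable => // x.
  by case/andP: (h x) => -> /= h1; apply: le_trans (p1 x k).
have Ibd f : measurable_fun setT f -> (forall x, 0 <= f x <= p x k) ->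
    0 <= \int[mu]_x f x <= mean k.
  move=> mf h; rewrite Rintegral_ge0 /=; last by move=> x _; case/andP: (h x).
  apply: le_Rintegral => //; [exact: unit| |by move=> x _; case/andP: (h x)].
  by apply: unit => // x; rewrite lexx dominated_ge0.
(* Chebyshev bounds the integral by [por] of the three means; [por_le] and the induction hypotheses
   then replace the means of [u] and [w]. *)
apply: (@le_trans _ _ (por (mean k) (\int[mu]_x u x) (\int[mu]_x w x))); last first.
  have /andP[? ?] := surv_child_bounds kids m t hm.
  have /andP[? ?] := surv_fold_bounds kids m ts hm.
  by apply: por_le => //; [exact: Ibd|exact: Ibd|exact: IH].
rewrite {1}/por.
have mdiv : measurable_fun setT (fun x => u x * w x / p x k).
  apply: measurable_funM; first exact: measurable_funM.
  by apply: measurableT_comp => //; exact: measurable_inv.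
have idiv : mu.-integrable setT (EFin \o (fun x => u x * w x / p x k)).
  apply: unit => // x; have /andP[a0 a1] := u0 x; have /andP[b0 b1] := w0 x.
  rewrite divr_ge0 ?mulr_ge0 ?dominated_ge0 //=.
  have [->|px] := eqVneq (p x k) 0; first by rewrite invr0 mulr0.
  have pp : 0 < p x k by rewrite lt_def px dominated_ge0.
  by rewrite ler_pdivrMr // ler_pM.
have iuw : mu.-integrable setT (EFin \o (fun x => u x + w x)).
  by apply: (eq_integrable measurableT _ _ _ (integrableD measurableT (unit _ mu' u0) (unit _ mw w0))).
rewrite RintegralB // RintegralD //; [|exact: unit|exact: unit].
rewrite /por lerD2l lerN2; apply: chebyshev => //; exact: cu.
Qed.

End Tree.
End Jensen.

(** * Outer probability and capacities *)

Section OuterProbability.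
Context d (T : measurableType d) (R : realType) (P : probability T R).
Implicit Types A B U : set T.

Lemma prob_measurable U : measurable U -> prob P U = P U.
Proof. exact: measurable_mu_extE. Qed.

Lemma le_prob A B : A `<=` B -> (prob P A <= prob P B)%E.
Proof. exact: le_mu_ext. Qed.

Lemma prob_ge0 A : (0 <= prob P A)%E.
Proof. exact: mu_ext_ge0. Qed.

Lemma prob_le1 A : (prob P A <= 1)%E.
Proof.
apply: (le_trans (le_prob (@subsetT _ A))).
by rewrite prob_measurable // probability_setT.
Qed.

Lemma prob_fin_num A : prob P A \is a fin_num.
Proof.
by rewrite ge0_fin_numE ?prob_ge0 // (le_lt_trans (prob_le1 A)) // ltry.
Qed.

Lemma prob_glb s A :
  (forall U, measurable U -> A `<=` U -> (s <= P U)%E) -> (s <= prob P A)%E.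
Proof.
move=> h; apply: le_ereal_inf_tmp => _ [F [mF AF] <-].
apply: (le_trans (h (\bigcup_k F k) _ AF)); first exact: bigcup_measurable.
by apply: measure_sigma_subadditive => //; exact: bigcup_measurable.
Qed.

Lemma measurable_hull A : exists U, [/\ measurable U, A `<=` U & P U = prob P A].
Proof.
have /choice[U hU] (n : nat) : exists U, [/\ measurable U, A `<=` U &
    (P U <= prob P A + n.+1%:R^-1%:E)%E].
  apply: contrapT => hn.
  have : (prob P A + n.+1%:R^-1%:E <= prob P A)%E.
    apply: prob_glb => U mU AU; rewrite leNgt; apply/negP => lt.
    by apply: hn; exists U; split => //; exact: ltW.
  rewrite -(fineK (prob_fin_num A)) -EFinD lee_fin gerDl leNgt.
  by rewrite invr_gt0 ltr0n.
have mI : measurable (\bigcap_n U n).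
  by apply: bigcap_measurableType => n _; case: (hU n).
have AI : A `<=` \bigcap_n U n by move=> x Ax n _; case: (hU n) => _ /(_ x Ax).
exists (\bigcap_n U n); split => //; apply/eqP; rewrite eq_le; apply/andP; split.
  apply/lee_addgt0Pr => e e0.
  pose n := Num.trunc (e^-1); have [mU AU lU] := hU n.
  apply: (@le_trans _ _ (P (U n))).
    by apply: le_measure; rewrite ?inE // => x; exact.
  apply: (le_trans lU); rewrite leeD2l // lee_fin.
  rewrite -[leRHS]invrK lef_pV2 ?posrE ?invr_gt0 // ltW //.
  by rewrite /n; apply: truncnS_gt.
by rewrite -(prob_measurable mI); exact: le_prob.
Qed.

(** Intersecting the hulls of all [A m] with [m >= n] gives increasing measurable sets that still
    cover [A n] and have no more probability than its own hull. *)
Lemma prob_bigcup_le s (A : nat -> set T) : nondecreasing_seq A ->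
  (forall n, (prob P (A n) <= s)%E) -> (prob P (\bigcup_n A n) <= s)%E.
Proof.
move=> ndA As; have /choice[U hU] n := measurable_hull (A n).
pose W n := \bigcap_(m in [set m | (n <= m)%N]) U m.
have mW n : measurable (W n).
  by apply: bigcap_measurableType => m _; case: (hU m).
have ndW : nondecreasing_seq W.
  by move=> n m nm; apply/subsetPset => x Wx k /= mk; apply: Wx => /=; exact: leq_trans mk.
have AW n : A n `<=` W n.
  move=> x Ax m /= nm; have [_ AU _] := hU m; apply: AU.
  by move/subsetPset: (ndA _ _ nm) => /(_ x Ax).
apply: (@le_trans _ _ (prob P (\bigcup_n W n))).
  by apply: le_prob => x [n _ Ax]; exists n => //; exact: AW.
have mUW : measurable (\bigcup_n W n) by apply: bigcup_measurable.
rewrite prob_measurable //.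
have /cvg_lim <- // := nondecreasing_cvg_mu (mu := P) mW mUW ndW.
apply: lime_le; first by apply/cvg_ex; eexists; exact: nondecreasing_cvg_mu.
apply: nearW => n /=; have [mU _ eU] := hU n.
apply: (le_trans _ (As n)); rewrite -eU.
by apply: le_measure; rewrite ?inE // => x; apply => /=.
Qed.

Lemma prob_bigcap_ge s (A : nat -> set T) : nonincreasing_seq A ->
  (forall n, measurable (A n)) ->
  (forall n, (s <= P (A n))%E) -> (s <= P (\bigcap_n A n))%E.
Proof.
move=> niA mA As.
have mI : measurable (\bigcap_n A n) by apply: bigcap_measurableType.
have cv : P \o A @ \oo --> P (\bigcap_n A n).
  apply: nonincreasing_cvg_mu => //.
  by rewrite (le_lt_trans (probability_le1 _ _)) // ltry.
rewrite -(cvg_lim _ cv) //; apply: lime_ge; first by apply/cvg_ex; eexists; exact: cv.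
exact: nearW.
Qed.

End OuterProbability.

(** * Projections of closed sets, compact boxes and countable cells *)

Section Targets.
Variable R : realType.
Implicit Types (D : set (nat -> R)) (c : nat -> nat) (x : seq R).

(** Closedness in the product topology of sequences, stated through explicit neighbourhoods. *)
Definition limit_closed D := forall z,
  (forall n : nat, exists2 y, D y & forall i, (i < n)%N -> `|y i - z i| <= n.+1%:R^-1) ->
  D z.

Definition prefixes D (k : nat) : set (seq R) := [set mkseq y k | y in D].

Definition boxed D c : set (nat -> R) :=
  D `&` [set y | forall i, `|y i| <= (c i)%:R].

Definition boxed_upto D c (n : nat) : set (nat -> R) :=
  D `&` [set y | forall i, (i < n)%N -> `|y i| <= (c i)%:R].

Definition cell (n : nat) (r : R) : int := Num.floor (n.+1%:R * r).

(** Membership depends on [x] only through finitely many integer cells, so the corresponding event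
    is measurable for any [D]. Boxing only the first [n] coordinates of the witness lets a box be
    built coordinate by coordinate. *)
Definition approx D c (k n : nat) : set (seq R) := [set x |
  exists2 y, boxed_upto D c n y & map (cell n) x = map (cell n) (mkseq y k)].

Lemma cell_near n r s : cell n r = cell n s -> `|r - s| <= n.+1%:R^-1.
Proof.
rewrite /cell => e.
have := floor_itv (n.+1%:R * r); have := floor_itv (n.+1%:R * s); rewrite e.
set f := Num.floor _; rewrite intrD => /andP[h1 h2] /andP[h3 h4].
have n0 : 0 < n.+1%:R :> R by [].
rewrite -(ler_pM2l n0) divff ?gt_eqF // -{1}(ger0_norm (ltW n0)) -normrM mulrBr.
rewrite ler_norml; lra.
Qed.

Lemma prefixes_approx D c k n : prefixes (boxed_upto D c n) k `<=` approx D c k n.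
Proof. by move=> _ [y Dy <-]; exists y. Qed.

(** By Tychonoff the witnesses for all [n] have a cluster point in the box; it lies in [D] by
    closedness, and its prefix is [x] because the cells shrink. *)
Lemma approx_limit D c k x : limit_closed D -> (forall n, approx D c k n x) ->
  prefixes (boxed D c) k x.
Proof.
move=> cD hx.
have /choice[y hy] n : exists y, boxed_upto D c n y /\
    map (cell n) x = map (cell n) (mkseq y k).
  by have [y] := hx n; exists y.
have sx : size x = k.
  by have [_ /(congr1 size)] := hy 0%N; rewrite !size_map size_iota.
(* [y n] is boxed only below [n]; zeros bring the tail into the compact box. *)
pose z n : nat -> R := fun i => if (i < n)%N then y n i else 0.
pose K : forall i : nat, set R := fun i => `[- (c i)%:R, (c i)%:R]%classic.
pose PT : topologicalType := prod_topology (fun _ : nat => R : topologicalType).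
pose KK : set PT :=
  [set f : nat -> R | forall i, K i (f i)].
have cK : compact KK.
  by apply: tychonoff => i; exact: segment_compact.
have zK : (z @ \oo) KK.
  exists 0%N => // n _ i; rewrite /K /= in_itv /= /z; case: ifP => [lin|_].
    by rewrite -ler_norml; have [[_ h] _] := hy n; exact: h.
  by rewrite oppr_le0 ler0n.
have [w [wK cw]] := cK (z @ \oo) _ zK.
have near_w (m : nat) (e : R) n0 : 0 < e -> exists n, [/\ (n0 <= n)%N, (m <= n)%N
    & forall i, (i < m)%N -> `|y n i - w i| <= e].
  move=> e0.
  have nb : nbhs (w : PT) [set f : nat -> R | forall i, (i < m)%N -> `|f i - w i| <= e].
    elim: m => [|m IH]; first by
      apply: (@filterS _ (nbhs (w : PT)) _ setT); [move=> f _ i|exact: filterT].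
    have hm : nbhs (w : PT) [set f : nat -> R | `|f m - w m| <= e].
      have pc := @proj_continuous nat (fun=> R : topologicalType) m (w : PT).
      have h : nbhs (w : PT) [set f : PT | ball (w m) e (f m)].
        exact: (pc _ (nbhsx_ballx (w m) e e0)).
      apply: filterS h => f /= ; rewrite -ball_normE /= distrC => h.
      exact: ltW.
    apply: filterS2 hm IH => f fm IHf i; rewrite ltnS leq_eqVlt => /predU1P[->//|].
    exact: IHf.
  have zn : (z @ \oo) [set z n | n in [set n | (maxn m n0 <= n)%N]].
    by exists (maxn m n0) => // n /= h; exists n.
  have [_ [[n /= h <-] hn]] := cw _ _ zn nb.
  move: h; rewrite geq_max => /andP[mn n0n].
  exists n; split => // i im; have := hn i im.
  by rewrite /z (leq_trans im mn).
exists w.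
  split; last by move=> i /=; have := wK i; rewrite /K /= in_itv /= ler_norml.
  apply: cD => n; have [m [_ _ hm]] := near_w n n.+1%:R^-1 0%N ltac:(by rewrite invr_gt0).
  by exists (y m) => //; have [[]] := hy m.
apply: (@eq_from_nth _ 0); rewrite size_mkseq // => i ik.
rewrite nth_mkseq //; apply/eqP; rewrite -subr_eq0 -normr_le0.
apply/ler_addgt0Pr => e e0; rewrite add0r.
have e20 : 0 < e / 2 by rewrite divr_gt0.
(* This threshold makes the cell width [n.+1%:R^-1] at most [e / 2]; the other half is the distance
   from [y n] to the cluster point. *)
have [n [n0n kn hn]] := near_w k (e / 2) (Num.trunc (e / 2)^-1) e20.
have h1 := hn i ik.
have h2 : `|y n i - x`_i| <= n.+1%:R^-1.
  apply: cell_near; have [_ /(congr1 (nth 0 ^~ i))] := hy n.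
  by rewrite (nth_map 0) ?sx // (nth_map 0) ?size_mkseq // nth_mkseq.
have h3 : n.+1%:R^-1 <= e / 2.
  rewrite -[leRHS]invrK lef_pV2 ?posrE ?invr_gt0 // ltW //.
  by apply: (lt_le_trans (truncnS_gt _)); rewrite ler_nat ltnS.
have -> : w i - x`_i = (y n i - x`_i) - (y n i - w i) by ring.
apply: (le_trans (ler_normB _ _)).
by rewrite (splitr e); apply: lerD => //; exact: le_trans h3.
Qed.

Section Measurability.
Context d (T : measurableType d).

(** There are countably many words of integers, so an arbitrary [L] yields a countable union of
    events. *)
Lemma measurable_codes (g : nat -> T -> int) k (L : set (seq int)) :
  (forall i a, measurable [set w | g i w = a]) ->
  measurable [set w | L (mkseq (g^~ w) k)].
Proof.
move=> mg.
have m1 a : measurable [set w | mkseq (g^~ w) k = a].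
  elim: k a => [|k IH] a.
    have [->|a0] := eqVneq a [::].
      by rewrite (_ : [set _ | _] = setT) //; apply/seteqP; split.
    rewrite (_ : [set _ | _] = set0) //; apply/seteqP; split => // w /= e.
    by rewrite -e eqxx in a0.
  case/lastP: a => [|a b].
    by rewrite (_ : [set _ | _] = set0) //; apply/seteqP; split.
  rewrite [X in measurable X](_ : _ =
      [set w | mkseq (g^~ w) k = a] `&` [set w | g k w = b]); first exact: measurableI.
  apply/seteqP; split => w /=; rewrite mkseqS.
    by move/rcons_inj => -[-> ->].
  by move=> [-> ->].
rewrite (_ : [set _ | _] = \bigcup_(n in [set n | exists2 a, L a & choice.pickle a = n])
    [set w | choice.pickle (mkseq (g^~ w) k) = n]); last first.
  apply/seteqP; split => w /= => [Lw|[_ [a La <-] /= e]].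
    by exists (choice.pickle (mkseq (g^~ w) k)) => //; exists (mkseq (g^~ w) k).
  by move/(pcan_inj choice.pickleK): e => ->.
apply: bigcup_measurable => _ [a La <-].
rewrite (_ : [set _ | _] = [set w | mkseq (g^~ w) k = a]) //.
by apply/seteqP; split => w /= [] => [/(pcan_inj choice.pickleK)|->].
Qed.

Lemma measurable_approx D c k n (f : nat -> T -> R) :
  (forall i, measurable_fun setT (f i)) ->
  measurable [set w | approx D c k n (mkseq (f^~ w) k)].
Proof.
move=> mf.
rewrite (_ : [set _ | _] = [set w |
    [set a | exists2 y, boxed_upto D c n y & a = map (cell n) (mkseq y k)]
      (mkseq (fun i => cell n (f i w)) k)]); last first.
  by apply/seteqP; split => w /= [y Dy e]; exists y => //;
    move: e; rewrite /mkseq -!map_comp.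
apply: (@measurable_codes (fun i w => cell n (f i w))) => i a.
have mc : measurable_fun setT (fun w => n.+1%:R * f i w) by exact: measurable_funM.
rewrite (_ : [set _ | _] = (fun w => n.+1%:R * f i w) @^-1` `[a%:~R, (a + 1)%:~R[).
  by rewrite -[X in measurable X]setTI; exact: mc.
apply/seteqP; split => w /=; rewrite in_itv /= -floor_eq.
  by move=> <-; exact: eqxx.
by move/eqP.
Qed.

Lemma measurable_prefixes D c k (f : nat -> T -> R) : limit_closed D ->
  (forall i, measurable_fun setT (f i)) ->
  measurable [set w | prefixes (boxed D c) k (mkseq (f^~ w) k)].
Proof.
move=> cD mf.
rewrite (_ : [set _ | _] = \bigcap_n [set w | approx D c k n (mkseq (f^~ w) k)]).
  by apply: bigcap_measurableType => n _; exact: measurable_approx.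
apply/seteqP; split => w /=.
  move=> [y [Dy hy] yE] n _; apply: prefixes_approx; exists y => //.
  by split => // i _; exact: hy.
by move=> h; apply: approx_limit => // n; exact: h.
Qed.

End Measurability.

Section Capacity.
Context d (T : measurableType d) (P : probability T R).
Variables (I : eqType) (l : seq I) (f : I -> nat -> T -> R) (k : nat).
Hypothesis mf : forall i j, measurable_fun setT (f i j).
Variable D : set (nat -> R).
Hypothesis cD : limit_closed D.

Definition hits (S : set (seq R)) : set T :=
  [set w | exists2 i, i \in l & S (mkseq (f i ^~ w) k)].

Lemma measurable_hits S :
  (forall i, i \in l -> measurable [set w | S (mkseq (f i ^~ w) k)]) ->
  measurable (hits S).
Proof.
move=> mS.
rewrite (_ : hits S = \bigcup_(i in [set` l]) [set w | S (mkseq (f i ^~ w) k)]).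
  exact: fin_bigcup_measurable.
by apply/seteqP; split=> w [i il h]; exists i.
Qed.

Lemma measurable_hits_boxed c : measurable (hits (prefixes (boxed D c) k)).
Proof. by apply: measurable_hits => i _; exact: measurable_prefixes. Qed.

(* The heart of the proof that analytic sets are capacitable: the box is chosen
   one coordinate at a time, using that outer probability is continuous along
   increasing unions of arbitrary sets. *)
Lemma capacity s :
  (forall c, (P (hits (prefixes (boxed D c) k)) <= s)%E) ->
  (prob P (hits (prefixes D k)) <= s)%E.
Proof.
move=> hs; rewrite leNgt; apply/negP => lt.
have s0 : (0 <= s)%E by apply: le_trans (hs (fun=> 0%N)).
pose p := fine (prob P (hits (prefixes D k))).
have pE : prob P (hits (prefixes D k)) = p%:E by rewrite fineK // prob_fin_num.
have sE : s = (fine s)%:E.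
  by rewrite fineK // ge0_fin_numE // (lt_trans lt) // pE ltry.
(* A level strictly in between, since the strict inequalities at finite stages become weak in the
   limit. *)
pose s' := (fine s + p) / 2.
have ltsp : fine s < p by rewrite -lte_fin -sE -pE.
have ss' : (s < s'%:E)%E by rewrite sE lte_fin /s'; lra.
have s'p : (s'%:E < p%:E)%E by rewrite lte_fin /s'; lra.
pose Db (cs : seq nat) := D `&` [set y : nat -> R |
  forall i, (i < size cs)%N -> `|y i| <= (nth 0%N cs i)%:R].
(* If every bound on the next coordinate dropped the outer probability to [s'] or below, so would
   the increasing union over all bounds, which restores the unbounded coordinate. *)
have /choice[M HM] (cs : seq nat) : exists M,
    (s'%:E < prob P (hits (prefixes (Db cs) k)))%E ->
    (s'%:E < prob P (hits (prefixes (Db (rcons cs M)) k)))%E.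
  apply: contrapT => /forallNP h.
  have {h} h M : (s'%:E < prob P (hits (prefixes (Db cs) k)))%E /\
      (prob P (hits (prefixes (Db (rcons cs M)) k)) <= s'%:E)%E.
    by have /not_implyP[h1 /negP] := h M; rewrite -leNgt.
  have [hlt _] := h 0%N.
  have : (prob P (\bigcup_M hits (prefixes (Db (rcons cs M)) k)) <= s'%:E)%E.
    apply: prob_bigcup_le => [m n mn|n]; last by case: (h n).
    apply/subsetPset => w [i il [y [Dy hy] yE]]; exists i => //; exists y => //.
    split => // j; rewrite size_rcons ltnS => js.
    have := hy j; rewrite size_rcons ltnS => /(_ js).
    rewrite !nth_rcons; case: ltnP => // _; case: eqP => // _ h1.
    by apply: le_trans h1 _; rewrite ler_nat.
  rewrite leNgt => /negP; apply; apply: lt_le_trans hlt _.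
  apply: le_prob => w [i il [y [Dy hy] yE]].
  exists (Num.trunc `|y (size cs)|).+1 => //; exists i => //; exists y => //.
  split => // j; rewrite size_rcons ltnS leq_eqVlt => /predU1P[->|js].
    by rewrite nth_rcons ltnn eqxx ltW // truncnS_gt.
  by rewrite nth_rcons js; exact: hy.
pose cs n := iter n (fun cs => rcons cs (M cs)) [::].
have scs n : size (cs n) = n by elim: n => //= n IH; rewrite size_rcons IH.
pose c i := M (cs i).
have ncs n i : (i < n)%N -> nth 0%N (cs n) i = c i.
  elim: n => // n IH; rewrite ltnS leq_eqVlt /= nth_rcons scs => /predU1P[->|lin].
    by rewrite ltnn eqxx.
  by rewrite lin IH.
have hcs n : (s'%:E < prob P (hits (prefixes (Db (cs n)) k)))%E.
  elim: n => [|n IH] /=; last exact: HM.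
  apply: (lt_le_trans s'p); rewrite -pE; apply: le_prob => w [i il [y Dy yE]].
  by exists i => //; exists y.
(* These measurable sets contain the hits with the first [n] coordinates boxed, and their
   intersection lies in the hits of the full box. *)
pose A n := hits (fun x => forall m, (m <= n)%N -> approx D c k m x).
have mA n : measurable (A n).
  apply: measurable_hits => i _.
  rewrite (_ : [set _ | _] = \bigcap_(m in [set m | (m <= n)%N])
    [set w | approx D c k m (mkseq (f i ^~ w) k)]) //.
  by apply: bigcap_measurableType => m _; exact: measurable_approx.
have niA : nonincreasing_seq A.
  move=> m n mn; apply/subsetPset => w [i il h]; exists i => // j jm.
  by apply: h; exact: leq_trans mn.
have PA n : (s'%:E <= P (A n))%E.
  apply: (le_trans (ltW (hcs n))); rewrite -(prob_measurable P (mA n)).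
  apply: le_prob => w [i il [y [Dy hy] yE]]; exists i => // m mn.
  rewrite -yE; apply: prefixes_approx; exists y => //; split => // j jm /=.
  rewrite -(ncs n) ?(leq_trans jm) //; apply: hy; rewrite scs.
  exact: leq_trans mn.
have := prob_bigcap_ge niA mA PA; rewrite leNgt => /negP; apply.
apply: le_lt_trans ss'; apply: le_trans (hs c).
apply: le_measure; rewrite ?inE //.
- exact: bigcap_measurableType.
- exact: measurable_hits_boxed.
move=> w Aw; apply: contrapT => hw.
have /choice[m hm] i : exists m, i \in l -> ~ approx D c k m (mkseq (f i ^~ w) k).
  apply: contrapT => /forallNP h; apply: hw.
  have il : i \in l by apply: contrapT => il; apply: (h 0%N) => /il.
  exists i => //; apply: approx_limit => // m; apply: contrapT => ha.
  exact: (h m).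
(* Each index of [l] fails at some stage; [l] is finite, so the largest of these stages defeats all
   of them at once. *)
have [i il hi] := Aw (\max_(i <- l) m i)%N Logic.I.
apply: (hm i il); apply: hi.
by apply: leq_bigmax_seq.
Qed.

End Capacity.
End Targets.

(** * Independence and disintegration *)

Section Independence.
Context (R : realType) (I : choiceType) (D : set I).
Context d (T : measurableType d) (P : probability T R).
Variables (X : I -> {RV P >-> R}) (mu : probability R R).
Hypothesis hX : iid D X mu.
Implicit Types J K : set I.

Definition info_gens J : set (set T) :=
  [set E | exists i A, [/\ J i, measurable A & E = X i @^-1` A]].

Definition info J : set (set T) := <<s info_gens J >>.

Definition cylinders J : set (set T) :=
  [set E | exists (K : {fset I}) (A : I -> set R),
    [/\ [set` K] `<=` J, forall i, measurable (A i) &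
        E = \bigcap_(i in [set` K]) (X i @^-1` A i)]].

Lemma measurable_preimage_rv i (A : set R) : measurable A -> measurable (X i @^-1` A).
Proof. by move=> mA; rewrite -[_ @^-1` _]setTI; exact: measurable_funP. Qed.

Lemma measurable_cylinders J : cylinders J `<=` measurable.
Proof.
move=> _ [K [A [_ mA ->]]]; apply: fin_bigcap_measurable => // i _.
exact: measurable_preimage_rv.
Qed.

Lemma cylinders_setI J : setI_closed (cylinders J).
Proof.
move=> _ _ [K1 [A1 [J1 m1 ->]]] [K2 [A2 [J2 m2 ->]]].
exists (K1 `|` K2)%fset, (fun i => (if i \in K1 then A1 i else setT) `&`
  (if i \in K2 then A2 i else setT)); split.
- by move=> i; rewrite /= in_fsetU => /orP[/J1|/J2].
- by move=> i; apply: measurableI; case: ifP.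
apply/seteqP; split => w /= => [[h1 h2] i|h].
  rewrite /= in_fsetU => _; split; case: ifP => // iK; [exact: h1|exact: h2].
by split=> i iK; have := h i; rewrite /= in_fsetU iK ?orbT => -[] //.
Qed.

Lemma sigma_cylinders J : <<s cylinders J >> = info J.
Proof.
apply/seteqP; split.
  apply: smallest_sub; first exact: smallest_sigma_algebra.
  move=> _ [K [A [KJ mA ->]]].
  pose TJ := g_sigma_algebraType (info_gens J).
  apply: (@fin_bigcap_measurable _ TJ) => // i Ki.
  by apply: sub_gen_smallest; exists i, (A i); split => //; exact: KJ.
apply: smallest_sub; first exact: smallest_sigma_algebra.
move=> _ [i [A [Ji mA ->]]]; apply: sub_gen_smallest.
exists [fset i]%fset, (fun=> A); split => //.
  by move=> j; rewrite /= in_fset1 => /eqP ->.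
apply/seteqP; split => w /=.
  by move=> h j; rewrite /= in_fset1 => /eqP ->.
by apply; rewrite /= in_fset1.
Qed.

Lemma measurable_info J : info J `<=` measurable.
Proof.
rewrite -sigma_cylinders; apply: smallest_sub; last exact: measurable_cylinders.
exact: sigma_algebra_measurable.
Qed.

Lemma info_mono J K : J `<=` K -> info J `<=` info K.
Proof.
move=> JK; apply: smallest_sub; first exact: smallest_sigma_algebra.
move=> _ [i [A [Ji mA ->]]]; apply: sub_gen_smallest.
by exists i, A; split => //; exact: JK.
Qed.

Lemma independence_extension (G : set (set T)) E : setI_closed G ->
  G `<=` measurable -> measurable E ->
  (forall A, G A -> P (A `&` E) = P A * P E)%E ->
  forall A, <<s G >> A -> P (A `&` E) = (P A * P E)%E.
Proof.
move=> GI mG mE h.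
have sm : <<s G >> `<=` measurable.
  by apply: smallest_sub => //; exact: sigma_algebra_measurable.
have fP B : P B \is a fin_num -> P B = (fine (P B))%:E by move=> ?; rewrite fineK.
have Pf B : measurable B -> P B \is a fin_num by move=> mB; exact: fin_num_measure.
pose TG := g_sigma_algebraType G.
apply: (@dynkin_induction _ TG G) => //.
- by rewrite setTI probability_setT mul1e.
- move=> S mS /= hS; have mS' := sm _ mS.
  rewrite probability_setC // muleBl ?mul1e ?fin_num_adde_defr ?Pf //.
  rewrite -hS (setIC (~` S)) -setDE measureD //; last by rewrite -ge0_fin_numE // Pf.
  by rewrite setIC.
move=> F mF tF hF; have mF' n := sm _ (mF n).
rewrite setI_bigcupl measure_bigcup //=; last 2 first.
- by move=> n _; exact: measurableI.
- exact: trivIset_setIr.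
rewrite measure_bigcup // (fP _ (Pf _ mE)) muleC -nneseriesZl //.
by apply: eq_eseriesr => n _; rewrite hF muleC (fP _ (Pf _ mE)).
Qed.

Lemma cylinders_independent J K A B : J `<=` D -> K `<=` D -> J `&` K = set0 ->
  cylinders J A -> cylinders K B -> P (A `&` B) = (P A * P B)%E.
Proof.
move=> JD KD JK [F [U [FJ mU ->]]] [G [V [GK mV ->]]].
have nFG i : i \in F -> i \in G -> False.
  by move=> /FJ Ji /GK Ki; have : (J `&` K) i by []; rewrite JK.
have [_ ind] := hX.
rewrite ind //; last by move=> i /FJ; exact: JD.
rewrite ind //; last by move=> i /GK; exact: KD.
pose W i := if i \in F then U i else V i.
have -> : (\bigcap_(i in [set` F]) X i @^-1` U i) `&`
    (\bigcap_(i in [set` G]) X i @^-1` V i) =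
    \bigcap_(i in [set` (F `|` G)%fset]) X i @^-1` W i.
  apply/seteqP; split => w /= => [[hF hG] i|h].
    rewrite /= in_fsetU /W; case: ifP => [iF _|_ /= iG]; [exact: hF|exact: hG].
  split=> i /= iF; have := h i; rewrite /= in_fsetU iF ?orbT /W.
    by rewrite iF => /(_ isT).
  by case: ifP => [/nFG/(_ iF)//|_ /(_ isT)].
rewrite ind; first last.
- by move=> i; rewrite /W; case: ifP.
- by move=> i; rewrite /= in_fsetU => /orP[/FJ/JD|/GK/KD].
rewrite (perm_big (enum_fset F ++ enum_fset G)) /=; last first.
  apply: uniq_perm; first exact: fset_uniq.
    rewrite cat_uniq !fset_uniq /= andbT; apply/hasPn => i iG.
    by apply/negP => iF; exact: (nFG i).
  by move=> i; rewrite in_fsetU mem_cat.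
rewrite big_cat /=; congr (_ * _)%E; rewrite big_seq [RHS]big_seq.
  by apply: eq_bigr => i iF; rewrite /W iF.
by apply: eq_bigr => i iG; rewrite /W; case: ifP => // /nFG /(_ iG).
Qed.

Lemma info_independent J K A B : J `<=` D -> K `<=` D -> J `&` K = set0 ->
  info J A -> info K B -> P (A `&` B) = (P A * P B)%E.
Proof.
move=> JD KD JK; rewrite -!sigma_cylinders => sA sB; rewrite setIC muleC.
apply: independence_extension sB; [exact: cylinders_setI|exact: measurable_cylinders| |].
  by rewrite sigma_cylinders in sA; exact: measurable_info sA.
move=> {}B cB; rewrite setIC muleC.
apply: independence_extension sA; [exact: cylinders_setI|exact: measurable_cylinders| |].
  exact: measurable_cylinders cB.
by move=> {}A cA; exact: cylinders_independent cA cB.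
Qed.

Section Disintegration.
Variable J : set I.
Let TJ := g_sigma_algebraType (info_gens J).

(** The identity, viewed as a random element in the same space with the coarser sigma-algebra
    [info J]; its law carries all variables of [J] at once. *)
Definition to_info (w : T) : TJ := w.

Lemma measurable_to_info : measurable_fun setT to_info.
Proof. by move=> _ A mA; rewrite setTI; exact: (@measurable_info J). Qed.

HB.instance Definition _ := isMeasurableFun.Build _ _ _ _ to_info measurable_to_info.

Lemma measurable_rv_info i : J i -> measurable_fun setT (X i : TJ -> R).
Proof.
by move=> Ji _ A mA; rewrite setTI; apply: sub_gen_smallest; exists i, A.
Qed.

Variable v : I.

Definition with_rv (w : T) : R * TJ := (X v w, to_info w).

Lemma measurable_with_rv : measurable_fun setT with_rv.
Proof. by apply: measurable_fun_pair => //; exact: measurable_to_info. Qed.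

HB.instance Definition _ := isMeasurableFun.Build _ _ _ _ with_rv measurable_with_rv.

Hypotheses (Jv : ~ J v) (JD : J `<=` D) (Dv : D v).

(** Since [X v] is independent of [info J], the pair has a product law: this is checked on
    rectangles and extended by uniqueness of product measures. *)
Lemma disintegration (H : set (R * TJ)) : measurable H ->
  P [set w | H (X v w, w)] = (\int[mu]_y P [set w | H (y, w)])%E.
Proof.
move=> mH.
have -> : P [set w | H (X v w, w)] = distribution P with_rv H by [].
rewrite -(@product_measure_unique _ _ _ _ _ mu (distribution P to_info)
  (distribution P with_rv)) //.
  rewrite /product_measure1; apply: eq_integral => y _ /=.
  by rewrite xsectionE.
move=> A B mA mB /=.
rewrite -[RHS]/(mu A * P B)%E -(hX.1 v Dv) //.
apply: (@info_independent [set v] J) => //.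
- by move=> _ ->.
- by apply/seteqP; split => // _ [->].
- by apply: sub_gen_smallest; exists v, A.
Qed.

Lemma measurable_section_prob (H : set (R * TJ)) : measurable H ->
  measurable_fun setT (fun y => P [set w | H (y, w)]).
Proof.
move=> mH; have := measurable_fun_xsection (distribution P to_info) mH.
rewrite (_ : _ \o _ = fun y => P [set w | H (y, w)]) //.
by apply/funext => y /=; rewrite xsectionE.
Qed.

End Disintegration.
End Independence.

(** * Words of random variables *)

Section Words.
Context (R : realType) d (T : measurableType d).
Implicit Types (fs : seq (T -> R)) (x : seq R).

Definition measurable_word fs := forall i, measurable_fun setT (nth (cst 0) fs i).

Lemma mkseq_word fs (w : T) :
  mkseq (fun i => nth (cst 0) fs i w) (size fs) = [seq f w | f <- fs].
Proof.
apply: (@eq_from_nth _ 0); rewrite size_mkseq ?size_map // => i si.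
by rewrite nth_mkseq // (nth_map (cst 0)).
Qed.

Lemma measurable_word_cat fs gs :
  measurable_word fs -> measurable_word gs -> measurable_word (fs ++ gs).
Proof. by move=> mf mg i; rewrite nth_cat; case: ifP. Qed.

Lemma measurable_word_map (U : eqType) (l : seq U) (g : U -> T -> R) :
  {in l, forall u, measurable_fun setT (g u)} -> measurable_word [seq g u | u <- l].
Proof.
move=> mg i; have [il|li] := ltnP i (size l); last first.
  by rewrite nth_default ?size_map.
case: l il mg => // u l il mg; rewrite (nth_map u) //; apply: mg.
exact: mem_nth.
Qed.

Lemma measurable_prefixes_word (D : set (nat -> R)) c fs : limit_closed D ->
  measurable_word fs ->
  measurable [set w | prefixes (boxed D c) (size fs) [seq f w | f <- fs]].
Proof.
move=> cD mf; have := measurable_prefixes c (size fs) cD mf.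
rewrite (_ : [set w | _ ] = [set w | prefixes (boxed D c) (size fs) [seq f w | f <- fs]]) //.
by apply/seteqP; split => w /=; rewrite mkseq_word.
Qed.

Lemma capacity_words (P : probability T R) (D : set (nat -> R)) (I : eqType)
  (l : seq I) (F : I -> seq (T -> R)) n s : limit_closed D ->
  (forall i, measurable_word (F i)) -> {in l, forall i, size (F i) = n} ->
  (forall c, (P [set w | exists2 i, i \in l &
      prefixes (boxed D c) n [seq f w | f <- F i]] <= s)%E) ->
  (prob P [set w | exists2 i, i \in l & prefixes D n [seq f w | f <- F i]] <= s)%E.
Proof.
move=> cD mF sF.
have hE S : [set w | exists2 i, i \in l & prefixes S n [seq f w | f <- F i]] =
    hits l (fun i j => nth (cst 0) (F i) j) n (prefixes S n).
  by apply/seteqP; split => w [i il]; have := sF i il => <- h;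
    exists i => //; move: h; rewrite /= mkseq_word.
rewrite hE => hs; by apply: capacity => // c; rewrite -hE.
Qed.

End Words.

(** * The law of a word under a boxed target *)

Section Law.
Context (R : realType) (mu : probability R R) (D : set (nat -> R)) (c : nat -> nat).
Hypothesis cD : limit_closed D.

Section Pair.
Context (I : choiceType) (DI : set I) d (T : measurableType d) (P : probability T R).
Variable X : I -> {RV P >-> R}.
Hypothesis hX : iid DI X mu.

(** Fixed letters, then the letter to be integrated, then variables read on the second component: a
    form that gives joint measurability on the product space. *)
Definition pair_word (J : set I) (x : seq R) (l : seq I) :
    seq (R * g_sigma_algebraType (info_gens X J) -> R) :=
  [seq cst a | a <- x] ++ (fst :: [seq (fun z => X u z.2) | u <- l]).

Lemma pair_wordE J x l z : [seq f z | f <- pair_word J x l] =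
  rcons x z.1 ++ [seq X u z.2 | u <- l].
Proof.
rewrite /pair_word map_cat /= -!map_comp -cats1 -catA.
by congr (_ ++ _); exact: map_id.
Qed.

Lemma size_pair_word J x l : size (pair_word J x l) = (size x + size l).+1.
Proof. by rewrite /pair_word size_cat /= !size_map addnS. Qed.

Lemma measurable_pair_word J x l : {in l, forall u, J u} ->
  measurable_word (pair_word J x l).
Proof.
move=> lJ; apply: measurable_word_cat; first exact: measurable_word_map.
case=> [|i] /=; first exact: measurable_fst.
have := @measurable_word_map R _ (R * g_sigma_algebraType (info_gens X J))%type _ l
  (fun u z => X u z.2); apply => u /lJ Ju.
have := measurable_rv_info (X := X) Ju => mu'.
exact: (measurableT_comp mu' measurable_snd).
Qed.

Lemma measurable_pair_prefixes J x l n : {in l, forall u, J u} ->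
  (size x + size l).+1 = n ->
  measurable [set z : R * g_sigma_algebraType (info_gens X J) |
    prefixes (boxed D c) n (rcons x z.1 ++ [seq X u z.2 | u <- l])].
Proof.
move=> lJ <-; have := measurable_prefixes_word c cD (measurable_pair_word x lJ).
rewrite size_pair_word; congr (measurable _); apply/seteqP.
by split => z /=; rewrite pair_wordE.
Qed.

Lemma word_disintegration x u l n : uniq (u :: l) -> {in u :: l, forall v, DI v} ->
  (size x + size l).+1 = n ->
  P [set w | prefixes (boxed D c) n (x ++ [seq X v w | v <- u :: l])] =
  (\int[mu]_y P [set w | prefixes (boxed D c) n (rcons x y ++ [seq X v w | v <- l])])%E.
Proof.
move=> /= /andP[ul _] lD sn.
rewrite -(@disintegration _ _ _ _ _ _ _ _ hX [set` l] u _ _ _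
  [set z | prefixes (boxed D c) n (rcons x z.1 ++ [seq X u z.2 | u <- l])]).
- by congr (P _); apply/seteqP; split => w /=; rewrite cat_rcons.
- exact/negP.
- by move=> v /= vl; apply: lD; rewrite inE vl orbT.
- by apply: lD; rewrite inE eqxx.
- exact: measurable_pair_prefixes.
Qed.

End Pair.

(** Integrating out one letter at a time leaves an iterated [mu]-integral in which neither the space
    nor the indices occur. *)
Lemma law_eq (I I' : choiceType) (DI : set I) (DI' : set I')
  d (T : measurableType d) (P : probability T R)
  d' (T' : measurableType d') (P' : probability T' R)
  (X : I -> {RV P >-> R}) (X' : I' -> {RV P' >-> R}) x l l' n :
  iid DI X mu -> iid DI' X' mu -> size l = size l' -> uniq l -> uniq l' ->
  {in l, forall u, DI u} -> {in l', forall u, DI' u} -> (size x + size l)%N = n ->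
  P [set w | prefixes (boxed D c) n (x ++ [seq X v w | v <- l])] =
  P' [set w | prefixes (boxed D c) n (x ++ [seq X' v w | v <- l'])].
Proof.
move=> hX hX'; elim: l l' x => [|u l IH] [|u' l'] x //.
  move=> _ _ _ _ _ _ /=.
  have [h|h] := pselect (prefixes (boxed D c) n (x ++ [::])).
    rewrite (_ : [set _ | _] = setT) ?probability_setT; last by apply/seteqP; split.
    by rewrite (_ : [set _ | _] = setT) ?probability_setT; last by apply/seteqP; split.
  rewrite (_ : [set _ | _] = set0) ?measure0; last by apply/seteqP; split.
  by rewrite (_ : [set _ | _] = set0) ?measure0; last by apply/seteqP; split.
move=> [ss] ul ul' lD lD' sn; rewrite (word_disintegration hX) //; last by rewrite -addnS.
rewrite (word_disintegration hX') //; last by rewrite -addnS -ss.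
apply: eq_integral => y _; apply: IH => //.
- by case/andP: ul.
- by case/andP: ul'.
- by move=> v vl; apply: lD; rewrite inE vl orbT.
- by move=> v vl; apply: lD'; rewrite inE vl orbT.
- by rewrite size_rcons addSn -addnS.
Qed.

End Law.

(** * Outer probabilities of cross sections *)

Section Sections.
Context (R : realType) (mu : probability R R) (D : set (nat -> R)).
Hypothesis cD : limit_closed D.
Context d (T : measurableType d) (P : probability T R) (Y : nat -> {RV P >-> R}).
Hypothesis hY : iid [set: nat] Y mu.

Definition spr (j : nat) (x : seq R) : \bar R :=
  prob P [set w | prefixes D j (x ++ [seq Y i w | i <- iota (size x) (j - size x)])].

(** One half of Fubini's theorem for outer probabilities; [surv_le] makes this half sufficient. *)
Lemma integral_le_spr j x (phi : R -> R) : (size x < j)%N ->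
  measurable_fun setT phi -> (forall y, 0 <= phi y) ->
  (forall y, ((phi y)%:E <= spr j (rcons x y))%E) ->
  (\int[mu]_y (phi y)%:E <= spr j x)%E.
Proof.
move=> xj mphi phi0 phile.
pose k := size x; pose J := [set i | (k < i)%N].
pose Q : probability (R * g_sigma_algebraType (info_gens Y J))%type R :=
  distribution P (with_rv Y J k).
pose l := iota k.+1 (j - k.+1).
have lJ : {in l, forall u, J u} by move=> u; rewrite mem_iota => /andP[].
have sl : (size x + size l).+1 = j by rewrite size_iota -addSn subnKC.
pose E S : set (R * g_sigma_algebraType (info_gens Y J)) :=
  [set z | prefixes S j (rcons x z.1 ++ [seq Y u z.2 | u <- l])].
have EE S : E S = [set z | exists2 i, i \in [:: tt] &
    prefixes S j [seq f z | f <- pair_word Y J x l]].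
  apply/seteqP; split => z; rewrite /E /= pair_wordE; first by exists tt.
  by case.
(* A measurable superset on the product space has measurable sections, so [disintegration] bounds
   [prob Q]. A measurable superset in [T] of the preimage need not come from a set of pairs, so the
   return from [Q] to [P] goes through boxed, measurable events. *)
apply: (@le_trans _ _ (prob Q (E D))).
  apply: prob_glb => U mU EU.
  have -> : Q U = (\int[mu]_y P [set w | U (y, w)])%E.
    apply: (disintegration hY) => //; first by rewrite /J /= ltnn.
  apply: ge0_le_integral => //.
  - by move=> y _; rewrite lee_fin.
  - exact/measurable_EFinP.
  - exact: measurable_section_prob.
  - move=> y _; apply: (le_trans (phile y)).
    have mUy : measurable [set w : g_sigma_algebraType (info_gens Y J) | U (y, w)].
      have := measurable_xsection y mU; congr (measurable _).
      by rewrite xsectionE.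
    rewrite -(prob_measurable P (measurable_info mUy)); apply: le_prob => w hw.
    by apply: EU; move: hw; rewrite /E /= size_rcons.
rewrite EE; apply: capacity_words => //.
- by move=> _; exact: measurable_pair_word.
- by move=> _ _; rewrite size_pair_word.
move=> c; rewrite -EE.
have mE : measurable (E (boxed D c)) by exact: measurable_pair_prefixes.
have -> : Q (E (boxed D c)) = P (with_rv Y J k @^-1` E (boxed D c)) by [].
rewrite -prob_measurable; last first.
  by rewrite -[X in measurable X]setTI; exact: measurable_with_rv.
apply: le_prob => w [y [Dy _] yE]; exists y => //.
by rewrite yE /= cat_rcons -(subnSK xj).
Qed.

Lemma spr_le j x : (size x <= j)%N -> (spr j.+1 x <= spr j x)%E.
Proof.
move=> xj; apply: le_prob => w [y Dy yE]; exists y => //.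
move: yE; rewrite subSn // -[(j - _).+1]addn1 iotaD map_cat catA cats1 mkseqS.
by case/rcons_inj.
Qed.

Lemma spr_same x : prefixes D (size x) x -> spr (size x) x = 1%E.
Proof.
move=> h; rewrite /spr subnn /= cats0 (_ : [set _ | _] = setT); last first.
  by apply/seteqP; split.
by rewrite prob_measurable // probability_setT.
Qed.

End Sections.

(** * Percolation on a tree *)

Section TreeCombinatorics.
Variable G : tree.
Implicit Types s t u v : G.

Lemma depth_iter_eq0 s : iter (depth s) parent s = rho.
Proof. by rewrite /depth; case: ex_minnP => n /eqP. Qed.

Lemma iter_parent_rho n : iter n parent rho = rho :> G.
Proof. by elim: n => //= n ->; exact: parent_root. Qed.

Lemma depth_min s n : iter n parent s = rho -> (depth s <= n)%N.
Proof. by move=> h; rewrite /depth; case: ex_minnP => m _; apply; apply/eqP. Qed.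

Lemma depth_rho : depth (rho : G) = 0%N.
Proof. by apply/eqP; rewrite -leqn0; exact: (@depth_min rho 0). Qed.

Lemma depth0_rho s : depth s = 0%N -> s = rho.
Proof. by move=> h; have := depth_iter_eq0 s; rewrite h. Qed.

Lemma depth_parent s : s <> rho -> depth s = (depth (parent s)).+1.
Proof.
move=> sr; apply/eqP; rewrite eqn_leq; apply/andP; split.
  by apply: depth_min; rewrite iterSr depth_iter_eq0.
case E : (depth s) => [|n]; first by case: sr; exact: depth0_rho.
by rewrite ltnS; apply: depth_min; rewrite -iterSr -E depth_iter_eq0.
Qed.

Lemma depth_iter n s : depth (iter n parent s) = (depth s - n)%N.
Proof.
elim: n => [|n IH]; first by rewrite subn0.
rewrite /= subnS -IH; have [->|/eqP h] := eqVneq (iter n parent s) rho.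
  by rewrite parent_root depth_rho.
by rewrite (depth_parent h).
Qed.

(** The root is its own parent and must not count as its own child. *)
Definition kids v : seq G := enum_fset (fset_set ([set t | parent t = v] `\ rho)).

Lemma uniq_kids v : uniq (kids v). Proof. exact: fset_uniq. Qed.

Lemma mem_kids v t : (t \in kids v) <-> (t <> rho /\ parent t = v).
Proof.
rewrite in_fset_set; last by apply: finite_setD; exact: locally_finite.
by rewrite inE /=; split => -[].
Qed.

Lemma depth_kid v t : t \in kids v -> depth t = (depth v).+1.
Proof. by move=> /mem_kids[/depth_parent -> ->]. Qed.

Definition subtree t : set G := [set u | exists i, iter i parent u = t].

Definition below v : set G := [set u | exists2 t, t \in kids v & subtree t u].

Lemma subtree_depth t u : subtree t u -> (depth t <= depth u)%N.
Proof. by move=> [i <-]; rewrite depth_iter leq_subr. Qed.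

Lemma below_not v : ~ below v v.
Proof.
by move=> [t /depth_kid tv /subtree_depth]; rewrite tv ltnn.
Qed.

Lemma subtreexx t : subtree t t. Proof. by exists 0%N. Qed.

Lemma below_subtree v : below v `<=` subtree v.
Proof.
by move=> u [t /mem_kids[_ tv] [i ui]]; exists i.+1; rewrite /= ui.
Qed.

Lemma subtree_nonroot t u : t <> rho -> subtree t u -> u <> rho.
Proof. by move=> tr [i ui] ur; apply: tr; rewrite -ui ur iter_parent_rho. Qed.

Lemma below_nonroot v : below v `<=` [set u | u <> rho].
Proof. by move=> u [t /mem_kids[tr _]]; exact: subtree_nonroot. Qed.

Lemma kids_disjoint v t t' : t \in kids v -> t' \in kids v -> t <> t' ->
  subtree t `&` subtree t' = set0.
Proof.
move=> tv tv' tt'; apply/seteqP; split => // u [[i ui] [j uj]].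
have h : (depth u - i = depth u - j)%N.
  by rewrite -!depth_iter ui uj (depth_kid tv) (depth_kid tv').
(* Positive depth rules out truncation in the subtractions, so [i = j]. *)
have : (0 < depth u - i)%N by rewrite -depth_iter ui (depth_kid tv).
by move=> ?; apply: tt'; rewrite -ui -uj; congr (iter _ _ _); lia.
Qed.

Fixpoint paths m v : seq (seq G) :=
  if m is m'.+1 then
    flatten [seq [seq t :: l | l <- paths m' t] | t <- kids v]
  else [:: [::]].

Lemma mem_pathsS m v l : (l \in paths m.+1 v) <->
  exists t l', [/\ t \in kids v, l' \in paths m t & l = t :: l'].
Proof.
split=> /=.
  by move=> /flatten_mapP[t tv /mapP[l' l'p ->]]; exists t, l'.
move=> [t [l' [tv l'p ->]]]; apply/flatten_mapP; exists t => //.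
by apply/mapP; exists l'.
Qed.

Lemma size_paths m v l : l \in paths m v -> size l = m.
Proof.
elim: m v l => [|m IH] v l; first by rewrite inE => /eqP ->.
by move=> /mem_pathsS[t [l' [_ l'p ->]]] /=; rewrite (IH _ _ l'p).
Qed.

Lemma paths_below m v l : l \in paths m v -> {in l, forall u, below v u}.
Proof.
elim: m v l => [|m IH] v l; first by rewrite inE => /eqP ->.
move=> /mem_pathsS[t [l' [tv l'p ->]]] u; rewrite inE => /predU1P[->|ul'].
  by exists t => //; exact: subtreexx.
by exists t => //; apply: below_subtree; exact: IH ul'.
Qed.

Lemma paths_uniq m v l : l \in paths m v -> uniq l.
Proof.
elim: m v l => [|m IH] v l; first by rewrite inE => /eqP ->.
move=> /mem_pathsS[t [l' [tv l'p ->]]] /=; rewrite (IH _ _ l'p) andbT.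
by apply/negP => /(paths_below l'p); exact: below_not.
Qed.

Lemma path_to_paths m v s : depth s = (depth v + m)%N -> iter m parent s = v ->
  [seq iter (m - i) parent s | i <- iota 1 m] \in paths m v.
Proof.
elim: m v => [|m IH] v ds sv; first by rewrite inE.
apply/mem_pathsS; exists (iter m parent s), [seq iter (m - i) parent s | i <- iota 1 m].
split.
- apply/mem_kids; split => //; move=> h.
  by have := depth_iter m s; rewrite h depth_rho ds addnS; lia.
- by apply: IH => //; rewrite depth_iter ds; lia.
rewrite /= subSS subn0; congr cons.
by rewrite -[2%N]addn1 iotaDl -map_comp; apply: eq_map => i /=; rewrite add1n subSS.
Qed.

Lemma path_seq_paths s : path_seq s \in paths (depth s) rho.
Proof. by apply: path_to_paths; rewrite ?depth_rho // depth_iter_eq0. Qed.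

Lemma path_seq_iter s a : (a <= depth s)%N ->
  path_seq (iter a parent s) = take (depth s - a) (path_seq s).
Proof.
move=> ad; rewrite /path_seq depth_iter -map_take take_iota.
have -> : minn (depth s - a) (depth s) = (depth s - a)%N by lia.
apply/eq_in_map => i; rewrite mem_iota => /andP[i0 ib].
by rewrite -iterD; congr iter; lia.
Qed.

End TreeCombinatorics.

(** * Independence across subtrees; recursions for both targets *)

Section Percolation.
Context (R : realType) (mu : probability R R) (G : tree).
Context d (T : measurableType d) (P : probability T R) (X : G -> {RV P >-> R}).
Hypothesis hX : iid [set s : G | s <> rho] X mu.

(** Subtrees of distinct children are disjoint, so inclusion-exclusion with independence folds
    [por 1]. Membership in [info] is carried along because it gives independence from the next
    child. *)
Lemma prob_union_kids v ts (A : G -> set T) : uniq ts -> {subset ts <= kids v} ->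
  (forall t, t \in ts -> info X (subtree t) (A t)) ->
  info X (fun u => exists2 t, t \in ts & subtree t u)
    [set w | exists2 t, t \in ts & A t w] /\
  fine (P [set w | exists2 t, t \in ts & A t w]) =
  foldr (fun t => por 1 (fine (P (A t)))) 0 ts.
Proof.
elim: ts => [|t ts IH] /=.
  move=> _ _ _; rewrite (_ : [set w | _] = set0); last by apply/seteqP; split => w [].
  by rewrite measure0; split => //; exact: sigma_algebra0.
move=> /andP[tts uts] tsv hA.
have [|t'|iB IHe] := IH uts.
- by move=> t' h; apply: tsv; rewrite inE h orbT.
- by move=> h; apply: hA; rewrite inE h orbT.
have iA : info X (subtree t) (A t) by apply: hA; rewrite inE eqxx.
set B := [set w | _] in iB IHe.
set J := fun u => _ in iB.
have -> : [set w | exists2 t0, t0 \in t :: ts & A t0 w] = A t `|` B.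
  apply/seteqP; split => w /=.
    move=> [t']; rewrite inE => /predU1P[->|h] Aw; first by left.
    by right; exists t'.
  by move=> [Aw|[t' h Aw]]; [exists t|exists t'] => //; rewrite inE ?eqxx // h orbT.
have tv : t \in kids v by apply: tsv; rewrite inE eqxx.
split.
  apply: (@measurableU _ (g_sigma_algebraType (info_gens X _))).
    apply: info_mono iA => u hu; exists t => //; exact: mem_head.
  apply: info_mono iB => u [t' h hu]; exists t' => //; by rewrite inE h orbT.
have mA := measurable_info iA; have mB := measurable_info iB.
have ind : P (A t `&` B) = (P (A t) * P B)%E.
  apply: (info_independent hX _ _ _ iA iB).
  - by move=> u; apply: subtree_nonroot; case/mem_kids: tv.
  - move=> u [t' h]; have : t' \in kids v by apply: tsv; rewrite inE h orbT.
    by move=> /mem_kids[h' _]; exact: subtree_nonroot.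
  apply/seteqP; split => // u [ut [t' h ut']].
  have tv' : t' \in kids v by apply: tsv; rewrite inE h orbT.
  have tt' : t <> t' by move=> e; rewrite e h in tts.
  by have <- := kids_disjoint tv tv' tt'.
have fA : P (A t) \is a fin_num by exact: fin_num_measure.
have fB : P B \is a fin_num by exact: fin_num_measure.
have -> : P (A t `|` B) = (P (A t) + P B - P (A t) * P B)%E.
  by rewrite -ind; apply: measureUfinl => //; rewrite -ge0_fin_numE.
rewrite fineB ?fin_numD ?fin_numM ?fA ?fB //.
by rewrite fineD // fineM // -IHe /por divr1.
Qed.

Section Corner.
Variable b : nat -> \bar R.

(** [b] is indexed from 0, so the children of a vertex at level [k] are tested against [b k]. *)
Fixpoint corner_open m k v (w : T) : Prop :=
  if m is m'.+1 then
    exists2 t, t \in kids v & ((X t w)%:E <= b k)%E /\ corner_open m' k.+1 t w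
  else True.

Lemma measurable_le_ereal (c : \bar R) : measurable [set x : R | (x%:E <= c)%E].
Proof.
case: c => [r| |].
- rewrite [X in measurable X](_ : _ = `]-oo, r]%classic).
    exact: measurable_itv.
  by apply/seteqP; split => x /=; rewrite in_itv /= lee_fin.
- rewrite [X in measurable X](_ : _ = setT) //.
  by apply/seteqP; split => // x /=; rewrite leey.
- rewrite [X in measurable X](_ : _ = set0) //.
  by apply/seteqP; split => // x /=; rewrite leeNy_eq.
Qed.

Let c k := fine (mu [set x : R | (x%:E <= b k)%E]).

Lemma corner_open_info m k v :
  info X (below v) [set w | corner_open m k v w].
Proof.
elim: m k v => [|m IH] k v.
  exact: (@measurableT _ (g_sigma_algebraType (info_gens X _))).
have [] := @prob_union_kids v (kids v)
  (fun t => [set w | ((X t w)%:E <= b k)%E /\ corner_open m k.+1 t w]).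
- exact: uniq_kids.
- by [].
- move=> t tv; apply: (@measurableI _ (g_sigma_algebraType (info_gens X _))).
    apply: sub_gen_smallest; exists t, [set x : R | (x%:E <= b k)%E].
    by split => //; [exact: subtreexx|exact: measurable_le_ereal].
  by apply: info_mono (IH k.+1 t); exact: below_subtree.
by [].
Qed.

Lemma corner_openS_prob m k v :
  fine (P [set w | corner_open m.+1 k v w]) =
  foldr (fun t => por 1 (c k * fine (P [set w | corner_open m k.+1 t w]))) 0 (kids v).
Proof.
have info_t t : info X (subtree t) [set w | ((X t w)%:E <= b k)%E].
  apply: sub_gen_smallest; exists t, [set x : R | (x%:E <= b k)%E].
  by split => //; [exact: subtreexx|exact: measurable_le_ereal].
have [] := @prob_union_kids v (kids v)
  (fun t => [set w | ((X t w)%:E <= b k)%E /\ corner_open m k.+1 t w]).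
- exact: uniq_kids.
- by [].
- move=> t tv; apply: (@measurableI _ (g_sigma_algebraType (info_gens X _))).
    exact: info_t.
  exact: (info_mono (@below_subtree _ t) (@corner_open_info m k.+1 t)).
move=> _ ->.
suff : {in kids v, forall t,
    fine (P [set w | ((X t w)%:E <= b k)%E /\ corner_open m k.+1 t w]) =
    c k * fine (P [set w | corner_open m k.+1 t w])}.
  elim: (kids v) => //= t ts IHt h; rewrite IHt; first by rewrite h ?mem_head.
  by move=> t' ht'; apply: h; rewrite inE ht' orbT.
move=> t /mem_kids[tr _].
have it : info X [set t] [set w | ((X t w)%:E <= b k)%E].
  apply: sub_gen_smallest; exists t, [set x : R | (x%:E <= b k)%E].
  by split => //; exact: measurable_le_ereal.
have ic := @corner_open_info m k.+1 t.
rewrite (info_independent hX _ _ _ it ic).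
- rewrite fineM ?fin_num_measure //; try exact: measurable_info it.
    congr (fine _ * _); rewrite /c -(hX.1 t) //; exact: measurable_le_ereal.
  exact: measurable_info ic.
- by move=> _ ->.
- exact: below_nonroot.
- by apply/seteqP; split => // _ [->] /below_not.
Qed.

(** Frozen beyond [n], as [section_vector] is, so that comparing the two vectors up to [n] compares
    them everywhere. *)
Definition corner_prod n j := \prod_(i < minn j n) c i.

Lemma corner_prodS n j : (j < n)%N -> corner_prod n j.+1 = corner_prod n j * c j.
Proof.
move=> jn; rewrite /corner_prod.
have -> : minn j.+1 n = j.+1 by lia.
have -> : minn j n = j by lia.
by rewrite big_ord_recr.
Qed.

(** Consecutive entries differ by the factor [c k], the retention probability for the corner target;
    [corner_prod n k] factors out because [por] is homogeneous of degree one. *)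
Lemma surv_corner n m k v : (k + m = n)%N ->
  surv (@kids G) m k v (corner_prod n) =
  corner_prod n k * fine (P [set w | corner_open m k v w]).
Proof.
elim: m k v => [|m IH] k v km.
  rewrite /= (_ : [set w | _] = setT); last by apply/seteqP; split.
  by rewrite probability_setT mulr1.
rewrite corner_openS_prob /=; elim: (kids v) => /= [|t ts IHt]; first by rewrite mulr0.
rewrite IHt IH; last by rewrite addSnnS.
rewrite corner_prodS; last by lia.
set z := corner_prod n k; rewrite /por divr1.
have [->|z0] := eqVneq z 0; first by rewrite !mul0r subr0 addr0.
by field.
Qed.

Lemma dominated_corner_prod n : dominated 0 (corner_prod n).
Proof.
have c01 i : 0 <= c i <= 1.
  have m := measurable_le_ereal (b i).
  rewrite /c fine_ge0 //= -lee_fin fineK ?fin_num_measure //.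
  exact: probability_le1.
have pc0 j : 0 <= corner_prod n j by apply: prodr_ge0 => i _; case/andP: (c01 i).
move=> j _; split => //.
have [jn|nj] := ltnP j n; last by rewrite /corner_prod !(minn_idPr _) // ltnW.
rewrite corner_prodS // ler_piMr //; by case/andP: (c01 j).
Qed.

End Corner.

Section Target.
Variables (D : set (nat -> R)) (n : nat).
Hypothesis cD : limit_closed D.

(** The values on the path to [v] are an argument [x], so that conditioning on them is
    substitution. *)
Fixpoint reaches (S : set (nat -> R)) m v x (w : T) : Prop :=
  if m is m'.+1 then
    exists2 t, t \in kids v & reaches S m' t (rcons x (X t w)) w
  else prefixes S n x.

Lemma reachesP S m v x w : reaches S m v x w <->
  exists2 l, l \in paths m v & prefixes S n (x ++ [seq X t w | t <- l]).
Proof.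
elim: m v x => [|m IH] v x /=.
  split=> [h|[l]]; first by exists [::]; rewrite ?inE // cats0.
  by rewrite inE => /eqP ->; rewrite cats0.
split=> [[t tv /IH[l lp]]|[l /mem_pathsS[t [l' [tv l'p ->]]]] /= h].
  by rewrite cat_rcons => h; exists (t :: l) => //; apply/mem_pathsS; exists t, l.
by exists t => //; apply/IH; exists l' => //; rewrite cat_rcons.
Qed.

Lemma reaches_prefix S m v x w : (size x + m)%N = n -> reaches S m v x w ->
  prefixes S (size x) x.
Proof.
move=> sx /reachesP[l lp [y Sy yE]]; exists y => //.
have := congr1 (take (size x)) yE; rewrite take_size_cat // => e; rewrite -[RHS]e.
rewrite /mkseq -map_take take_iota; congr (map _ (iota 0 _)); lia.
Qed.

Section Box.
Variable c : nat -> nat.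
Let S := boxed D c.

Lemma measurable_reaches_pair m t x : (size x + m).+1 = n ->
  measurable [set z : R * g_sigma_algebraType (info_gens X (below t)) |
    reaches S m t (rcons x z.1) z.2].
Proof.
move=> sx.
rewrite (_ : [set _ | _] = \bigcup_(l in [set` paths m t])
   [set z : R * g_sigma_algebraType (info_gens X (below t)) |
    prefixes S n (rcons x z.1 ++ [seq X u z.2 | u <- l])]).
  apply: fin_bigcup_measurable => // l /= lp; apply: measurable_pair_prefixes => //.
    exact: paths_below lp.
  by rewrite (size_paths lp).
apply/seteqP; split => z /= => [/reachesP[l lp h]|[l lp h]]; first by exists l.
by apply/reachesP; exists l.
Qed.

Lemma reaches_info m t x y : (size x + m).+1 = n ->
  info X (below t) [set w | reaches S m t (rcons x y) w].
Proof.
move=> sx; have := measurable_xsection y (measurable_reaches_pair (t := t) sx).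
by rewrite xsectionE.
Qed.

Lemma reaches_child_info m t x : (size x + m).+1 = n ->
  info X (subtree t) [set w | reaches S m t (rcons x (X t w)) w].
Proof.
move=> sx; pose TJ := g_sigma_algebraType (info_gens X (subtree t)).
have m1 : measurable_fun setT (X t : TJ -> R).
  by apply: measurable_rv_info; exact: subtreexx.
have m2 : measurable_fun setT
    (id : TJ -> g_sigma_algebraType (info_gens X (below t))).
  by move=> _ A mA; rewrite setTI; apply: info_mono mA; exact: below_subtree.
have := measurable_fun_pair m1 m2 measurableT (measurable_reaches_pair (t := t) sx).
by rewrite setTI.
Qed.

Lemma reaches_child_integral m t x : t <> rho -> (size x + m).+1 = n ->
  P [set w | reaches S m t (rcons x (X t w)) w] =
  (\int[mu]_y P [set w | reaches S m t (rcons x y) w])%E.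
Proof.
move=> tr sx.
exact: (disintegration hX (@below_not _ t) (@below_nonroot _ t) tr
  (measurable_reaches_pair (t := t) sx)).
Qed.

Lemma reachesS_prob m v x : (size x + m).+1 = n ->
  fine (P [set w | reaches S m.+1 v x w]) =
  foldr (fun t => por 1 (fine (P [set w | reaches S m t (rcons x (X t w)) w]))) 0
    (kids v).
Proof.
move=> sx.
have [] := @prob_union_kids v (kids v)
  (fun t => [set w | reaches S m t (rcons x (X t w)) w]) => //.
- exact: uniq_kids.
- by move=> t _; exact: reaches_child_info.
Qed.

End Box.
End Target.
End Percolation.

(** * Domination of the target percolation by independent percolation *)

Section Domination.
Context (R : realType) (mu : probability R R) (G : tree).
Context d (T : measurableType d) (P : probability T R) (X : G -> {RV P >-> R}).
Hypothesis hX : iid [set s : G | s <> rho] X mu.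
Context d' (T' : measurableType d') (P' : probability T' R) (Y : nat -> {RV P' >-> R}).
Hypothesis hY : iid [set: nat] Y mu.
Variables (D : set (nat -> R)) (n : nat).
Hypothesis cD : limit_closed D.

(** On [S] the function agrees with its running supremum over [S], which is monotone on the whole
    line. This is the source of measurability in [y] for section probabilities. *)
Lemma measurable_nondecreasing_on (S : set R) (f : R -> R) : measurable S ->
  (forall y, 0 <= f y <= 1) -> (forall y, ~ S y -> f y = 0) ->
  (forall y z, S y -> S z -> y < z -> f y <= f z) -> measurable_fun setT f.
Proof.
move=> mS f01 f0 fS.
pose A y := [set r | r = 0 \/ exists z, [/\ S z, z <= y & r = f z]].
have A1 y r : A y r -> r <= 1.
  by move=> [->//|[z [_ _ ->]]]; case/andP: (f01 z).
have hA y : has_sup (A y) by split; [exists 0; left|exists 1 => r /A1].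
have leA y r : A y r -> r <= sup (A y).
  by move=> h; apply: ub_le_sup => //; case: (hA y).
have -> : f = fun y => sup (A y) * \1_S y.
  apply/funext => y; rewrite indicE; have [Sy|Sy] := pselect (S y); last first.
    by rewrite memNset // mulr0 f0.
  rewrite mem_set // mulr1; apply/eqP; rewrite eq_le; apply/andP; split.
    by apply: leA; right; exists y.
  apply: ge_sup; first by case: (hA y).
  move=> r [->|[z [Sz zy ->]]]; first by case/andP: (f01 y).
  by case: (ltgtP z y) zy => // [zy _|-> //]; exact: fS.
apply: measurable_funM; last exact: measurable_indic.
apply: nondecreasing_measurable => // y z yz.
apply: ge_sup; first by case: (hA y).
move=> r [->|[u [Su uy ->]]]; apply: leA; first by left.
by right; exists u; split => //; exact: le_trans yz.
Qed.

(* Clipping the index to [size x, n] makes the vector monotone on all of nat. *)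
Definition section_vector x j : R := fine (spr D Y (minn (maxn j (size x)) n) x).

Let q := section_vector.

Lemma section_vectorE x j :
  (q x j)%:E = spr D Y (minn (maxn j (size x)) n) x.
Proof. by rewrite /q /section_vector fineK // prob_fin_num. Qed.

Lemma section_vector01 x j : 0 <= q x j <= 1.
Proof. by rewrite -!lee_fin section_vectorE prob_ge0 prob_le1. Qed.

Lemma dominated_section_vector x k : (size x <= n)%N -> dominated k (q x).
Proof.
move=> xn j _; split; first by case/andP: (section_vector01 x j.+1).
rewrite -lee_fin !section_vectorE.
have [e|e] : minn (maxn j.+1 (size x)) n = minn (maxn j (size x)) n \/
    minn (maxn j.+1 (size x)) n = (minn (maxn j (size x)) n).+1 by lia.
  by rewrite e.
by rewrite e; apply: spr_le; lia.
Qed.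

Hypothesis tpD : forall x, (size x < n)%N ->
  tp2 [set j | (size x < j)%N /\ (j <= n)%N] (fun y j => spr D Y j (rcons x y)).

Lemma section_vector_ratio x y z i j : (size x < n)%N -> y < z ->
  (size x < i)%N -> (i < j)%N ->
  q (rcons x z) i * q (rcons x y) j <= q (rcons x y) i * q (rcons x z) j.
Proof.
move=> xn yz xi ij.
have [e|e] : minn (maxn i (size x).+1) n = minn (maxn j (size x).+1) n \/
    (minn (maxn i (size x).+1) n < minn (maxn j (size x).+1) n)%N by lia.
  by rewrite /q /section_vector !size_rcons e mulrC.
rewrite -lee_fin !EFinM !section_vectorE !size_rcons.
by apply: (tpD xn) => //=; rewrite leq_min xn geq_minr leq_max ltnSn orbT.
Qed.

Lemma reaches_le_surv c m v x : (size x + m)%N = n ->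
  fine (P [set w | reaches X n (boxed D c) m v x w]) <=
  surv (@kids G) m (size x) v (q x).
Proof.
have bD k s : prefixes (boxed D c) k s -> prefixes D k s.
  by move=> [y [Dy _] yE]; exists y.
elim: m v x => [|m IH] v x sx.
  have e : size x = n by rewrite -sx addn0.
  have e' : minn (maxn (size x) (size x)) n = size x by lia.
  rewrite /= /q /section_vector e' /=.
  have [h|h] := pselect (prefixes (boxed D c) n x).
    rewrite spr_same ?e //; last exact: bD.
    by rewrite -lee_fin fineK ?fin_num_measure // ?probability_le1 //;
      rewrite (_ : [set _ | _] = setT) //; apply/seteqP; split.
  rewrite [X in P X](_ : _ = set0); last by apply/seteqP; split.
  by rewrite measure0 fine_ge0 // prob_ge0.
have xn : (size x < n)%N by lia.
have sx1 : (size x + m).+1 = n by rewrite -addnS.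
have domx k : dominated k (q x) by apply: dominated_section_vector; lia.
(* Off the projection of [D] no extension can hit; on it the entry of [q x] at [size x] is 1, the
   scale of [por] in [reachesS_prob]. *)
have [h|h] := pselect (prefixes D (size x) x); last first.
  rewrite [X in P X](_ : _ = set0); last first.
    apply/seteqP; split => // w /= hw; apply: h; apply: bD.
    exact: (reaches_prefix sx hw).
  by rewrite measure0; case/andP: (surv_bounds (@kids G) m.+1 v (domx (size x))).
have q1 : q x (size x) = 1.
  rewrite /q /section_vector (_ : minn _ _ = size x) ?spr_same //; lia.
rewrite (reachesS_prob hX) //= q1.
suff child t : t \in kids v ->
    fine (P [set w | reaches X n (boxed D c) m t (rcons x (X t w)) w]) <=
    surv (@kids G) m (size x).+1 t (q x).
  have : {subset kids v <= kids v} by [].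
  elim: {1 3 4}(kids v) => //= t ts IHt sub.
  have tv : t \in kids v by apply: sub; rewrite mem_head.
  have := surv_child_bounds (@kids G) m t (domx (size x)); rewrite q1 => /andP[s0 s1].
  have := surv_fold_bounds (@kids G) m ts (domx (size x)); rewrite q1 => /andP[f0 f1].
  have IH' := IHt (fun u hu => sub u (mem_behead (s := t :: ts) hu)).
  have P01 (A : set T) : measurable A -> 0 <= fine (P A) <= 1.
    by move=> mA; rewrite -!lee_fin fineK ?fin_num_measure // measure_ge0 probability_le1.
  apply: por_le => //; [|  |exact: child].
    by apply: P01; apply: measurable_info; exact: reaches_child_info.
  have P0 u : 0 <= fine (P [set w | reaches X n (boxed D c) m u (rcons x (X u w)) w]) <= 1.
    by apply: P01; apply: measurable_info; exact: reaches_child_info.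
  by elim: (ts) => /= [|u us IHu]; [rewrite lexx ler01|apply: por_bounds].
move=> /mem_kids[tr _].
(* The values of [X t] that keep the word in the boxed projection; the box makes this set
   measurable. *)
pose S : set R := [set y | prefixes (boxed D c) (size x).+1 (rcons x y)].
have mS : measurable S.
  have := @measurable_prefixes_word R _ R D c ([seq cst a | a <- x] ++ [:: id]) cD.
  rewrite size_cat size_map addn1; set A := [set w | _].
  have -> : A = S.
    apply/seteqP; split => y; rewrite /A /S /= map_cat /= -map_comp -cats1;
      rewrite (_ : map _ x = x) //; exact: map_id.
  apply; apply: measurable_word_cat; first exact: measurable_word_map.
  by case=> [|[|i]] /=.
(* On [S] the leading entry is 1, so total positivity makes every entry nondecreasing in [y], hence
   measurable; zero vectors off [S] preserve the ratio order. *)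
pose p y j : R := \1_S y * q (rcons x y) (maxn j (size x).+1).
have p_in y j : S y -> p y j = q (rcons x y) (maxn j (size x).+1).
  by move=> Sy; rewrite /p indicE mem_set // mul1r.
have p_out y j : ~ S y -> p y j = 0.
  by move=> Sy; rewrite /p indicE memNset // mul0r.
have p01 y j : 0 <= p y j <= 1.
  have [Sy|Sy] := pselect (S y); last by rewrite p_out // lexx ler01.
  by rewrite p_in // section_vector01.
have qS y : S y -> q (rcons x y) (size x).+1 = 1.
  move=> Sy; rewrite /q /section_vector size_rcons.
  have -> : minn (maxn (size x).+1 (size x).+1) n = size (rcons x y).
    by rewrite size_rcons; lia.
  by rewrite spr_same // size_rcons; exact: bD.
have mp j : measurable_fun setT (p^~ j).
  apply: (@measurable_nondecreasing_on S) => // [y Sy|y z Sy Sz yz]; first exact: p_out.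
  rewrite !p_in //; set i := maxn j _.
  have : ((size x).+1 <= i)%N by rewrite leq_maxr.
  rewrite leq_eqVlt => /predU1P[<-|xi]; first by rewrite !qS.
  by have := section_vector_ratio xn yz (ltnSn _) xi; rewrite !qS // !mul1r.
have domp y : dominated (size x).+1 (p y).
  move=> j hj; have [Sy|Sy] := pselect (S y); last by rewrite !p_out.
  rewrite !p_in // (maxn_idPl hj) (maxn_idPl (leqW hj)).
  by apply: (@dominated_section_vector _ 0) => //; rewrite size_rcons.
have ratp y z : y < z -> ratio_le (size x).+1 (p y) (p z).
  move=> yz i j hi ij.
  have [Sy|Sy] := pselect (S y); last by rewrite !(p_out y) // mulr0 mul0r.
  have [Sz|Sz] := pselect (S z); last by rewrite !(p_out z) // mulr0 mul0r.
  rewrite !p_in // (maxn_idPl hi) (maxn_idPl (leq_trans hi (ltnW ij))).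
  exact: section_vector_ratio.
have meanle j : ((size x).+1 <= j)%N -> \int[mu]_y p y j <= q x j.
  move=> hj; rewrite -lee_fin section_vectorE.
  have ip : mu.-integrable setT (EFin \o p^~ j) by apply: measurable_unit_integrable.
  rewrite /Rintegral fineK; last exact: integrable_fin_num.
  apply: (integral_le_spr cD hY); [lia|exact: mp|by move=> y; case/andP: (p01 y j)|].
  move=> y; have [Sy|Sy] := pselect (S y); last by rewrite p_out // prob_ge0.
  rewrite p_in // section_vectorE size_rcons.
  by have -> : minn (maxn (maxn j (size x).+1) (size x).+1) n =
    minn (maxn j (size x)) n by lia.
have mR y : measurable [set w | reaches X n (boxed D c) m t (rcons x y) w].
  by apply: measurable_info; exact: reaches_info.
have mRy : measurable_fun setT
    (fun y => P [set w | reaches X n (boxed D c) m t (rcons x y) w]).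
  exact: (measurable_section_prob (measurable_reaches_pair (X := X) (t := t) cD c sx1)).
rewrite (reaches_child_integral hX cD c tr sx1).
pose r y := fine (P [set w | reaches X n (boxed D c) m t (rcons x y) w]).
have rE y : P [set w | reaches X n (boxed D c) m t (rcons x y) w] = (r y)%:E.
  by rewrite fineK // fin_num_measure.
have mr : measurable_fun setT r by apply: measurableT_comp => //; exact: measurable_fine.
have r01 y : 0 <= r y <= 1.
  by rewrite -!lee_fin -rE measure_ge0 probability_le1.
rewrite (eq_integral (EFin \o r)); last by move=> y _; rewrite /= rE.
rewrite -/(Rintegral mu setT r).
(* The induction hypothesis applies pointwise on [S], and off [S] the event is empty. Jensen's
   inequality then passes to the mean vector, which [meanle] puts below [q x]. *)
apply: (@le_trans _ _ (\int[mu]_y surv (@kids G) m (size x).+1 t (p y))).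
  apply: le_Rintegral => //.
  - exact: measurable_unit_integrable.
  - apply: measurable_unit_integrable; first exact: measurable_surv.
    move=> y; have /andP[-> h2] := surv_bounds (@kids G) m t (domp y).
    by apply: (le_trans h2); case/andP: (p01 y (size x).+1).
  move=> y _; have [Sy|Sy] := pselect (S y); last first.
    rewrite /r [X in P X](_ : _ = set0); last first.
      apply/seteqP; split => // w /= hw; apply: Sy.
      have := reaches_prefix _ hw; rewrite size_rcons addSn; exact.
    by rewrite measure0; case/andP: (surv_bounds (@kids G) m t (domp y)).
  have := IH t (rcons x y); rewrite size_rcons addSn => /(_ sx1) /le_trans; apply.
  apply: surv_le => //; first by apply: dominated_section_vector; rewrite size_rcons.
  by move=> j hj; rewrite p_in // (maxn_idPl hj).
have p1 y j : p y j <= 1 by case/andP: (p01 y j).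
apply: (le_trans (surv_jensen mu _ mp p1 m t domp ratp)).
apply: surv_le => //.
exact: dominated_mean.
Qed.

Lemma prob_reaches_le v :
  (prob P [set w | reaches X n D n v [::] w] <=
   (surv (@kids G) n 0 v (q [::]))%:E)%E.
Proof.
have rE S : [set w | reaches X n S n v [::] w] = [set w | exists2 l,
    l \in paths n v & prefixes S n [seq f w | f <- [seq (X t : T -> R) | t <- l]]].
  apply/seteqP; split => w /=.
    by move=> /reachesP[l lp h]; exists l => //; rewrite -map_comp.
  by move=> [l lp h]; apply/reachesP; exists l => //; rewrite -map_comp in h.
rewrite rE; apply: capacity_words => //.
- by move=> l; exact: measurable_word_map.
- by move=> l lp; rewrite size_map (size_paths lp).
move=> c; rewrite -rE.
have mR : measurable [set w | reaches X n (boxed D c) n v [::] w].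
  rewrite rE.
  rewrite (_ : [set _ | _] = \bigcup_(l in [set` paths n v])
    [set w | prefixes (boxed D c) n [seq f w | f <- [seq (X t : T -> R) | t <- l]]]) //.
  apply: fin_bigcup_measurable => // l /= lp.
  have := @measurable_prefixes_word R _ T D c [seq (X t : T -> R) | t <- l] cD.
  rewrite size_map (size_paths lp); apply; exact: measurable_word_map.
rewrite -(fineK (fin_num_measure P _ mR)) lee_fin.
exact: (@reaches_le_surv c n v [::]).
Qed.

(** An outer probability may depend on the underlying space. Boxed events are measurable and equally
    likely for [Y] and along the path to [s], so [capacity_words] carries the bound across. *)
Lemma section_vector_le s j : (0 < j <= n)%N -> depth s = j ->
  ((q [::] j)%:E <= prob P [set w | prefixes D j [seq X t w | t <- path_seq s]])%E.
Proof.
move=> /andP[j0 jn] sj.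
rewrite section_vectorE /= maxn0 (minn_idPl jn) /spr /= subn0.
have lp := path_seq_paths s; rewrite sj in lp.
pose F := [seq (Y i : T' -> R) | i <- iota 0 j].
rewrite [X in prob P' X](_ : _ = [set w | exists2 i, i \in [:: tt] &
    prefixes D j [seq f w | f <- F]]); last first.
  by apply/seteqP; split => w /=; rewrite -map_comp; [exists tt|case].
apply: capacity_words => //; first by move=> _; exact: measurable_word_map.
  by move=> _ _; rewrite size_map size_iota.
move=> c; rewrite [X in P' X](_ : _ = [set w | prefixes (boxed D c) j
    ([::] ++ [seq Y i w | i <- iota 0 j])]); last first.
  by apply/seteqP; split => w /=; rewrite -map_comp; [case|exists tt].
rewrite (law_eq c cD hY hX (l' := path_seq s)) //.
- have mA : measurable [set w | prefixes (boxed D c) j ([::] ++ [seq X v w | v <- path_seq s])].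
    pose fs := [seq (X t : T -> R) | t <- path_seq s].
    have sf : size fs = j by rewrite size_map (size_paths lp).
    have mfs : measurable_word fs by exact: measurable_word_map.
    have := measurable_prefixes_word c cD mfs; congr (measurable _).
    by apply/seteqP; split => w /=; rewrite sf /fs -map_comp.
  rewrite -(prob_measurable P mA); apply: le_prob => w [y [Dy _] yE].
  by exists y.
- by rewrite size_iota (size_paths lp).
- exact: iota_uniq.
- exact: paths_uniq lp.
- by move=> u /(paths_below lp); exact: below_nonroot.
- by rewrite size_iota.
Qed.

End Domination.

(** * Targets, rays and the boundary *)

Section TargetCoordinates.
Variables (R : realType) (N : option nat).

Lemma pointwise_limit_closed (B : set (Rpow R N)) (u : nat -> Rpow R N) (z : Rpow R N) :
  closed B -> (forall n, B (u n)) -> (forall i, u n i @[n --> \oo] --> z i) -> B z.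
Proof.
move=> cB uB uz; apply: (@closed_cvg _ _ \oo _ u B cB) => //; first exact: nearW.
apply/cvg_sup => i; apply/cvg_image.
  by apply/seteqP; split => // r _; exists (fun=> r).
move=> A zA; exists ((fun f : Rpow R N => f i) @^-1` A); first exact: uz.
apply/seteqP; split => [_ [f ? <-] //|r Ar].
by exists (fun=> r).
Qed.

Lemma coord_lt (y : Rpow R N) i (h : le_height i.+1 N) :
  Defs.coord y i = y (Sub i h).
Proof. by rewrite /Defs.coord insubT. Qed.

Lemma coord_ge (y : Rpow R N) i : ~~ le_height i.+1 N -> Defs.coord y i = 0.
Proof. by move=> h; rewrite /Defs.coord insubF //; exact: negbTE. Qed.

(** Padding by zeros places finite and infinite [N] in one sequence space; the padding survives
    limits because a limit of zeros is zero. *)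
Lemma limit_closed_coords (B : set (Rpow R N)) : closed B ->
  limit_closed [set Defs.coord y | y in B].
Proof.
move=> cB z hz.
have /choice[u hu] n : exists y, B y /\ forall i, (i < n)%N -> `|Defs.coord y i - z i| <= n.+1%:R^-1.
  by have [_ [y By <-]] := hz n; exists y.
have uz i : Defs.coord (u n) i @[n --> \oo] --> z i.
  apply/cvgrPdist_le => e e0; near=> n.
  have [_ h] := hu n; rewrite distrC; apply: (le_trans (h i _)); first by near: n; exact: nbhs_infty_gt.
  near: n; apply: filterS (near_infty_natSinv_lt (PosNum e0)) => n; exact: ltW.
exists (fun i => z (val i)).
  apply: (pointwise_limit_closed cB (u := u)) => [n|[i h]]; first by have [] := hu n.
  have := uz i; rewrite (_ : (fun n => Defs.coord (u n) i) = fun n => u n (exist _ i h)) //.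
  by apply/funext => n; rewrite (coord_lt _ h).
apply/funext => i; have [h|h] := boolP (le_height i.+1 N); first by rewrite coord_lt.
rewrite coord_ge //; have := uz i.
rewrite (_ : (fun n => Defs.coord (u n) i) = fun=> 0); last first.
  by apply/funext => n; rewrite coord_ge.
by move=> /(cvg_lim (@Rhausdorff R)) <-; rewrite lim_cst //; exact: Rhausdorff.
Unshelve. all: by end_near.
Qed.

Lemma proj_targetE k (B : set (Rpow R N)) :
  proj_target k B = prefixes [set Defs.coord y | y in B] k.
Proof.
apply/seteqP; split => [_ [y By <-]|_ [_ [y By <-] <-]]; last by exists y.
by exists (Defs.coord y) => //; exists y.
Qed.

Lemma section_probE d (T : measurableType d) (P : probability T R)
  (Y : nat -> {RV P >-> R}) (B : set (Rpow R N)) j x :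
  section_prob Y B j x = spr [set Defs.coord y | y in B] Y j x.
Proof. by rewrite /section_prob /spr /cross_section proj_targetE. Qed.

End TargetCoordinates.

(** * Rays as maximal root paths *)

Section Rays.
Variable G : tree.
Implicit Types s t u v : G.

Lemma root_path_ancestor (Q : set G) s i : root_path Q -> Q s -> Q (iter i parent s).
Proof. by move=> [_ Qp _] Qs; elim: i => //= i; exact: Qp. Qed.

Lemma root_path_level (Q : set G) s j : root_path Q -> Q s -> (j <= depth s)%N ->
  exists2 u, Q u & depth u = j.
Proof.
move=> hQ Qs js; exists (iter (depth s - j) parent s).
  exact: root_path_ancestor.
by rewrite depth_iter subKn.
Qed.

Lemma path_to_level s u v : path_to s u -> path_to s v -> depth u = depth v -> u = v.
Proof.
move=> [i _ <-] [j _ <-]; rewrite !depth_iter => e.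
have [h|h] : i = j \/ (depth s - i = 0 /\ depth s - j = 0)%N by lia.
  by rewrite h.
by rewrite (@depth0_rho _ (iter i _ _)) ?depth_iter ?h.1 // (@depth0_rho _ (iter j _ _)) ?depth_iter ?h.2.
Qed.

Lemma path_to_root s : path_to s rho.
Proof. by exists (depth s) => //; exact: depth_iter_eq0. Qed.

Lemma path_to_parent s u : path_to s u -> path_to s (parent u).
Proof. by move=> [i _ <-]; exists i.+1. Qed.

Lemma path_to_self s : path_to s s. Proof. by exists 0%N. Qed.

Section Descent.
Variables (s0 : G) (next : G -> G).
Hypothesis nextP : forall v, next v \in kids v \/ (kids v = [::] /\ next v = v).

Let chain i := iter i next s0.

Definition descent : set G := [set u | exists i, path_to (chain i) u].

Lemma descent_mono i j u : (i <= j)%N -> path_to (chain i) u -> path_to (chain j) u.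
Proof.
move=> ij; rewrite -(subnKC ij); elim: (j - i)%N => [|k IH]; first by rewrite addn0.
move=> /IH [a _ au]; rewrite addnS /chain /= -/(chain (i + k)).
case: (nextP (chain (i + k))) => [/mem_kids[_ h]|[_ ->]]; last by exists a.
by exists a.+1 => //; rewrite iterSr h.
Qed.

Lemma chain_depth i : depth (chain i) = (depth s0 + i)%N \/
  exists i', kids (chain i') = [::] /\ (depth (chain i') < depth s0 + i)%N.
Proof.
elim: i => [|i [IH|[i' [h1 h2]]]]; first by left; rewrite addn0.
  case: (nextP (chain i)) => [/depth_kid h|[h _]]; first by left; rewrite /= h IH addnS.
  by right; exists i; rewrite IH addnS ltnS leqnn.
by right; exists i'; split => //; rewrite addnS ltnS ltnW.
Qed.

Lemma root_path_descent : root_path descent.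
Proof.
split.
- by exists 0%N; exact: path_to_root.
- by move=> u [i h]; exists i; exact: path_to_parent.
- move=> u v [i hu] [j hv]; apply: (@path_to_level (chain (maxn i j))).
    exact: descent_mono (leq_maxl _ _) hu.
  exact: descent_mono (leq_maxr _ _) hv.
Qed.

(** A level reached by the chain admits no second vertex, and a vertex of [Q'] below all these
    levels would yield a child of the leaf where the chain stops. *)
Lemma ray_descent : ray descent.
Proof.
split; first exact: root_path_descent.
move=> Q' hQ' sub u Q'u.
have hu w : descent w -> depth w = depth u -> descent u.
  by move=> Dw e; have [_ _ h] := hQ'; rewrite -(h w u) //; exact: sub.
have [le|lt] := leqP (depth u) (depth s0).
  have s0D : descent s0 by exists 0%N; exact: path_to_self.
  by have [w Dw e] := root_path_level root_path_descent s0D le; exact: hu e.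
have chD i : descent (chain i) by exists i; exact: path_to_self.
case: (chain_depth (depth u - depth s0)) => [e|[i [ki]]].
  by apply: (hu _ (chD (depth u - depth s0)%N)); rewrite e subnKC // ltnW.
rewrite subnKC ?(ltnW lt) // => lt'.
pose w := iter (depth u - (depth (chain i)).+1) parent u.
have dw : depth w = (depth (chain i)).+1 by rewrite depth_iter subKn.
have Q'w : Q' w by exact: root_path_ancestor.
have wr : w <> rho by move=> e; rewrite e depth_rho in dw.
suff : w \in kids (chain i) by rewrite ki.
apply/mem_kids; split => //; have [_ Qp h] := hQ'; apply: h.
- exact: Qp.
- exact/sub/chD.
- by move: dw; rewrite (depth_parent wr) => -[].
Qed.

End Descent.

Lemma vertex_on_ray s : exists2 Q, ray Q & Q s.
Proof.
pose next v := head v (kids v).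
have nextP v : next v \in kids v \/ (kids v = [::] /\ next v = v).
  by rewrite /next; case: (kids v) => [|t ts]; [right|left; exact: mem_head].
exists (descent s next); first exact: ray_descent.
by exists 0%N; exact: path_to_self.
Qed.

Variable N : option nat.
Hypothesis hG : has_height G N.

Lemma depth_le_height s : le_height (depth s) N.
Proof.
case: N hG => //= n hn; have [Q rQ Qs] := vertex_on_ray s.
by have [_] := hn Q rQ; exact.
Qed.

(** For infinite height, a ray with a deepest vertex could be prolonged by a child, against
    maximality. *)
Lemma ray_level (Q : set G) n : ray Q -> le_height n N -> exists2 s : G, Q s & depth s = n.
Proof.
move=> rQ; case: N hG => [m|] /= hn nm.
  have [[s Qs sm] _] := hn Q rQ.
  by apply: (root_path_level rQ.1 Qs); rewrite sm.
apply: contrapT => hno.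
have bd s : Q s -> (depth s < n)%N.
  move=> Qs; rewrite ltnNge; apply/negP => h; apply: hno.
  exact: (root_path_level rQ.1 Qs).
have [Q0 Qp Qu] := rQ.1.
have [s Qs smax] : exists2 s, Q s & forall t, Q t -> (depth t <= depth s)%N.
  pose p i := `[< exists2 s : G, Q s & depth s = i >].
  have exp : exists i, p i by exists 0%N; apply/asboolP; exists (rho : G); rewrite ?depth_rho.
  have ubp i : p i -> (i <= n)%N by move=> /asboolP[s /bd h <-]; exact: ltnW.
  case: (ex_maxnP exp ubp) => i /asboolP[s Qs si] imax; exists s => // t Qt.
  by rewrite si; apply: imax; apply/asboolP; exists t.
have [t tr tp] := hn s.
have dt : depth t = (depth s).+1 by rewrite (depth_parent tr) tp.
have : Q t.
  apply: (rQ.2 (Q `|` [set t])); [|by move=> u; left|by right].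
  split.
  - by left.
  - by move=> u [/Qp|->]; left => //; rewrite tp.
  - move=> u v [Qu1|->] [Qv|->] e //; first exact: Qu.
    + by have := smax _ Qu1; rewrite e dt ltnn.
    + by have := smax _ Qv; rewrite -e dt ltnn.
by move=> /smax; rewrite dt ltnn.
Qed.

End Rays.

Lemma le_height_trans N m n : (m <= n)%N -> le_height n N -> le_height m N.
Proof. by case: N => //= k mn; exact: leq_trans. Qed.

(** * From finite levels to the boundary *)

Section Boundary.
Context (R : realType) (N : option nat) (G : tree).
Hypothesis hG : has_height G N.
Context d (T : measurableType d) (P : probability T R) (X : G -> {RV P >-> R}).

Section Target.
Variable B : set (Rpow R N).
Let D := [set Defs.coord y | y in B].

(** Level 0 is excluded because the root is always open, whereas [reaches] at level 0 asks [D] to be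
    nonempty. *)
Lemma boundary_reaches n : (0 < n)%N -> le_height n N ->
  root_to_boundary X B `<=` [set w | reaches X n D n rho [::] w].
Proof.
move=> n0 nN w [Q rQ Qo]; have [s Qs sn] := ray_level hG rQ nN.
apply/reachesP; exists (path_seq s); first by rewrite -sn path_seq_paths.
case: (Qo _ Qs) => [e|]; first by move: n0; rewrite -sn e depth_rho.
by rewrite proj_targetE sn.
Qed.

Lemma prefixes_root_to s :
  [set w | prefixes D (depth s) [seq X t w | t <- path_seq s]] `<=` root_to X B s.
Proof.
move=> w [y Dy yE] _ [a _ <-]; have [ad|da] := leqP a (depth s); last first.
  by left; apply: depth0_rho; rewrite depth_iter; lia.
right; rewrite proj_targetE path_seq_iter // depth_iter map_take -yE.
exists y => //; rewrite /mkseq -map_take take_iota; congr (map _ (iota 0 _)); lia.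
Qed.

End Target.

Variables (b : nat -> \bar R) (w : T).

Lemma corner_open_le m m' k (v : G) : (m <= m')%N ->
  corner_open X b m' k v w -> corner_open X b m k v w.
Proof.
elim: m m' k v => //= m IH [|m'] // k v mm' /= [t tv [Xt h]].
by exists t => //; split => //; exact: IH h.
Qed.

Lemma corner_open_ninfty i m k (v : G) : b i = -oo%E -> (k <= i < k + m)%N ->
  ~ corner_open X b m k v w.
Proof.
move=> bi; elim: m k v => [|m IH] k v; first by rewrite addn0; lia.
move=> /andP[ki im] /= [t tv [Xt h]].
have [e|ne] := eqVneq k i; first by rewrite e bi leeNy_eq in Xt.
by apply: IH h; lia.
Qed.

Let good (v : G) := forall m, le_height (depth v + m) N ->
  corner_open X b m (depth v) v w.

(** The step of Koenig's lemma: if each of the finitely many children failed at some level, the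
    largest of these levels would contradict [good v]. *)
Lemma good_kid v : good v -> kids v <> [::] ->
  exists t, [/\ t \in kids v, ((X t w)%:E <= b (depth v))%E & good t].
Proof.
move=> gv kv; apply: contrapT => hno.
have /choice[m hm] t : exists m, t \in kids v -> le_height (depth t + m) N /\
    ~ (((X t w)%:E <= b (depth v))%E /\ corner_open X b m (depth t) t w).
  have [tv|/negP tv] := boolP (t \in kids v); last by exists 0%N.
  have [Xt|Xt] := pselect ((X t w)%:E <= b (depth v))%E; last first.
    exists 0%N => _; rewrite addn0; split; first exact: depth_le_height.
    by move=> [].
  have : ~ good t by move=> gt; apply: hno; exists t.
  by move=> /existsNP[m /not_implyP[h1 h2]]; exists m => _; split => // -[].
pose M := (\max_(t <- kids v) m t)%N.
have hM : le_height (depth v + M.+1) N.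
  have [t0 t0v] : exists t0, t0 \in kids v.
    by case: (kids v) kv => // t ts _; exists t; exact: mem_head.
  move: hm; case: (N) => //= n hm.
  have := (hm t0 t0v).1; rewrite (depth_kid t0v) => h0.
  suff : (M <= n - (depth v).+1)%N by lia.
  apply/bigmax_leqP_seq => t tv _.
  by have := (hm t tv).1; rewrite (depth_kid tv); lia.
have [t tv [Xt ct]] := gv _ hM.
apply: (hm t tv).2; split => //; rewrite (depth_kid tv).
by apply: corner_open_le ct; exact: leq_bigmax_seq.
Qed.

Lemma corner_boundary : (forall i, le_height i.+1 N -> b i != -oo%E) ->
  (forall n, le_height n N -> corner_open X b n 0 rho w) ->
  root_to_boundary X (corner N b) w.
Proof.
move=> bN hw.
(* For the descent to be a ray, [next] must choose a child wherever there is one; at good vertices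
   it chooses a good child. *)
have /choice[next hnext] v : exists u,
    (u \in kids v \/ (kids v = [::] /\ u = v)) /\
    (good v -> kids v <> [::] ->
      [/\ u \in kids v, ((X u w)%:E <= b (depth v))%E & good u]).
  have [kv|kv] := pselect (kids v = [::]); first by exists v; split; [right|].
  have [gv|gv] := pselect (good v).
    by have [t [tv Xt gt]] := good_kid gv kv; exists t; split; [left|].
  case E : (kids v) kv => [//|t ts] _; exists t; split => //.
  by left; exact: mem_head.
have nextP v := (hnext v).1.
exists (descent rho next); first exact: ray_descent.
(* A vertex at depth [j.+1] is governed by [b j], hence the predecessor. *)
pose below_b (v : G) := forall a, iter a parent v <> rho ->
  ((X (iter a parent v) w)%:E <= b (depth (iter a parent v)).-1)%E.
have inv i : good (iter i next rho) /\ below_b (iter i next rho).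
  elim: i => [|i [gi bi]] /=.
    split; last by move=> a; rewrite iter_parent_rho.
    by move=> m; rewrite depth_rho; exact: hw.
  set v := iter i next rho in gi bi *.
  have [kv|kv] := pselect (kids v = [::]).
    by case: (nextP v) => [|[_ ->]] //; rewrite kv.
  have [uv Xu gu] := (hnext v).2 gi kv; split => // -[|a] /= hr.
    by rewrite (depth_kid uv).
  by move: hr; rewrite -iterS iterSr; case/mem_kids: uv => _ ->; exact: bi.
move=> _ [i [a _ <-]]; set u := iter a parent _.
have bu : below_b u by move=> a'; rewrite /u -iterD; exact: (inv i).2.
have [ur|ur] := pselect (u = rho); [by left|right].
(* Openness of [u] asks for a full point of the corner extending the values on its path; [z] fills
   the later coordinates, which exist because no relevant [b j] is [-oo]. *)
have /choice[z hz] j : exists z : R, le_height j.+1 N -> (z%:E <= b j)%E.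
  have [h|h] := boolP (le_height j.+1 N); last by exists 0.
  case E : (b j) => [r| |]; [by exists r|by exists 0; rewrite leey|].
  by have := bN j h; rewrite E.
pose l := [seq X t w | t <- path_seq u].
have sl : size l = depth u by rewrite size_map size_map size_iota.
pose f j := if (j < depth u)%N then nth 0 l j else z j.
exists (fun j => f (val j)).
  move=> [j jN] /=; rewrite /f; case: ifP => [ju|_]; last exact: hz.
  rewrite (nth_map rho) ?size_map ?size_iota //.
  rewrite (nth_map 0%N) ?size_iota // nth_iota //.
  have dj : depth (iter (depth u - (1 + j)) parent u) = j.+1.
    by rewrite depth_iter add1n subKn.
  have := bu (depth u - (1 + j))%N; rewrite dj /=; apply => e.
  by rewrite e depth_rho in dj.
apply: (@eq_from_nth _ 0); rewrite size_mkseq ?sl // => j ju.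
have jN : le_height j.+1 N by apply: le_height_trans (depth_le_height hG u).
by rewrite nth_mkseq // (coord_lt _ jN) /f /= ju.
Qed.

End Boundary.

(** * Comparison at each level and passage to the limit *)

Section Comparison.
Context (R : realType) (N : option nat) (G : tree).
Hypothesis hG : has_height G N.
Context (mu : probability R R) d (T : measurableType d) (P : probability T R).
Context (X : G -> {RV P >-> R}).
Hypothesis hX : iid [set s : G | s <> rho] X mu.
Context d' (T' : measurableType d') (P' : probability T' R).
Context (Y : nat -> {RV P' >-> R}).
Hypothesis hY : iid [set: nat] Y mu.
Context (B : set (Rpow R N)).
Hypothesis hB : closed B.
Hypothesis hM : forall k : nat, (1 <= k)%N ->
  forall x : seq R, size x = k.-1 ->
  tp2 [set j : nat | (k <= j)%N /\ le_height j N]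
    (fun (y : R) (j : nat) => section_prob Y B j (rcons x y)).
Variable b : nat -> \bar R.
Hypothesis hb : forall n : nat, le_height n N ->
  forall s : G, depth s = n ->
  (\prod_(i < n) mu [set x : R | x%:E <= b i])%E = prob P (root_to X B s).

Lemma boundary_le_corner_open n : le_height n N ->
  (prob P (root_to_boundary X B) <= P [set w | corner_open X b n 0 rho w])%E.
Proof.
case: n => [|m] nN.
  by rewrite [X in P X](_ : _ = setT) ?probability_setT ?prob_le1.
set n := m.+1 in nN *; pose D := [set Defs.coord y | y in B].
have cD : limit_closed D by exact: limit_closed_coords.
have tpD x : (size x < n)%N -> tp2 [set j | (size x < j)%N /\ (j <= n)%N]
    (fun y j => spr D Y j (rcons x y)).
  move=> xn y z i j [/= xi iN] [/= xj jN] ij yz; rewrite -!section_probE.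
  apply: (hM (k := (size x).+1)) => //=; split => //; exact: le_height_trans nN.
apply: (le_trans (le_prob P (boundary_reaches hG (X := X) (B := B) (ltn0Sn m) nN))).
apply: (le_trans (prob_reaches_le hX hY cD tpD rho)).
have mC : measurable [set w | corner_open X b n 0 rho w].
  by apply: measurable_info; exact: (corner_open_info hX).
rewrite -(fineK (fin_num_measure P _ mC)) lee_fin.
have -> : fine (P [set w | corner_open X b n 0 rho w]) =
    surv (@kids G) n 0 rho (corner_prod mu b n).
  by rewrite (surv_corner hX) // /corner_prod min0n big_ord0 mul1r.
apply: surv_le.
- exact: dominated_section_vector.
- exact: dominated_corner_prod.
move=> j _; have -> : section_vector Y D n [::] j = section_vector Y D n [::] (minn j n).
  by rewrite /section_vector /= !maxn0 -minnA minnn.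
have -> : corner_prod mu b n j = corner_prod mu b n (minn j n).
  by rewrite /corner_prod -minnA minnn.
set j' := minn j n; have j'n : (j' <= n)%N by rewrite geq_minr.
have [->|j0] := posnP j'.
  rewrite /corner_prod min0n big_ord0.
  by case/andP: (section_vector01 Y D n [::] 0).
have j'N : le_height j' N by exact: le_height_trans nN.
(* [hb] speaks of vertices, so one at level [j'] is taken from some ray. *)
have [Q rQ _] := vertex_on_ray (rho : G).
have [s _ sj] := ray_level hG rQ j'N.
rewrite -lee_fin.
apply: (le_trans (section_vector_le hX hY cD (n := n) _ sj)); first by rewrite j0.
have h : (prob P [set w | prefixes D j' [seq X t w | t <- path_seq s]] <=
    prob P (root_to X B s))%E.
  by rewrite -sj; apply: le_prob; exact: prefixes_root_to.
apply: (le_trans h); rewrite -(hb j'N sj).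
rewrite /corner_prod (minn_idPl j'n).
rewrite (big_morph EFin EFinM (erefl _)).
rewrite le_eqVlt; apply/orP; left; apply/eqP; apply: eq_bigr => i _.
by rewrite fineK // fin_num_measure //; exact: measurable_le_ereal.
Qed.

Lemma boundary_le_corner_boundary :
  (prob P (root_to_boundary X B) <= prob P (root_to_boundary X (corner N b)))%E.
Proof.
(* An entry [-oo] empties the corner; then no path survives to level [i.+1] and the comparison at
   that level makes the left-hand side 0. *)
have [[i [iN bi]]|hno] := pselect (exists i, le_height i.+1 N /\ b i = -oo%E).
  apply: (le_trans (boundary_le_corner_open iN)).
  rewrite [X in P X](_ : _ = set0) ?measure0 ?prob_ge0 //.
  by apply/seteqP; split => // w; apply: (corner_open_ninfty bi); rewrite /= ltnSn.
have bN i : le_height i.+1 N -> b i != -oo%E.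
  by move=> iN; apply/eqP => bi; apply: hno; exists i.
(* Capping the level at [N] lets one decreasing sequence of events serve finite and infinite
   height. *)
pose trunc n := if N is Some k then minn n k else n.
have truncN n : le_height (trunc n) N.
  by rewrite /trunc; case: (N) => //= k; exact: geq_minr.
pose A n := [set w | corner_open X b (trunc n) 0 rho w].
have mA n : measurable (A n).
  by apply: measurable_info; exact: (corner_open_info hX).
have niA : nonincreasing_seq A.
  move=> m n mn; apply/subsetPset => w; apply: corner_open_le.
  by rewrite /trunc; case: (N) => // k; lia.
apply: (le_trans (prob_bigcap_ge niA mA (fun n => boundary_le_corner_open (truncN n)))).
rewrite -(prob_measurable P); last exact: bigcapT_measurable.
apply: le_prob => w Aw; apply: (corner_boundary hG bN) => n nN.
have := Aw n Logic.I; rewrite /A /=; have -> // : trunc n = n.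
by rewrite /trunc; move: nN; case: (N) => //= k; lia.
Qed.

End Comparison.

Theorem theorem4p6 (R : realType) (N : option nat) (G : tree)
  (hG : has_height G N)
  (mu : probability R R)
  (d : measure_display) (T : measurableType d) (P : probability T R)
  (X : G -> {RV P >-> R}) (hX : iid [set s : G | s <> rho] X mu)
  (d' : measure_display) (T' : measurableType d') (P' : probability T' R)
  (Y : nat -> {RV P' >-> R}) (hY : iid [set: nat] Y mu)
  (B : set (Rpow R N)) (hB : closed B)
  (hM : forall k : nat, (1 <= k)%N ->
        forall x : seq R, size x = k.-1 ->
        tp2 [set j : nat | (k <= j)%N /\ le_height j N]
            (fun (y : R) (j : nat) => section_prob Y B j (rcons x y)))
  (b : nat -> \bar R)
  (hb : forall n : nat, le_height n N ->
        forall s : G, depth s = n ->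
        (\prod_(i < n) mu [set x : R | x%:E <= b i])%E =
        prob P (root_to X B s)) :
  (prob P (root_to_boundary X B) <=
   prob P (root_to_boundary X (corner N b)))%E.
Proof.
exact: (boundary_le_corner_boundary hG hX hY hB hM hb).
Qed.
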